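(* Let $X$ be an arbitrary symmetric sequence space. Then the set $\mathcal F(X)$ is nonempty, its largest element is $1/\alpha_X$ and its smallest element is $1/\beta_X$ (with the convention $1/0=\infty$).
   Context: A Banach sequence lattice is a Banach space $E$ of real sequences such that $x\in E$, $|y_k|\le|x_k|$ imply $y\in E$, $\|y\|_E\le\|x\|_E$. $u^*$ is the nonincreasing rearrangement of $(|u_k|)$. A symmetric sequence space is a Banach sequence lattice $X\subset\ell^\infty$ such that $x\in X$, $y^*=x^*$ imply $y\in X$, $\|y\|_X=\|x\|_X$; standing assumption: $X$ is separable or has the Fatou property. Dilations: $\sigma_ma=(a_{[(m-1+n)/m]})_n$, $\sigma_{1/m}a=(\frac1m\sum_{k=(n-1)m+1}^{nm}a_k)_n$; Boyd indices $\alpha_X=-\lim_{m}\frac{\log_2\|\sigma_{1/m}\|_X}{\log_2m}$, $\beta_X=\lim_m\frac{\log_2\|\sigma_m\|_X}{\log_2m}$. Sequences $x,y$ have the same ordered distribution if $y_{\pi(k)}=x_k$ for all $k$ for some permutation $\pi$ of $\mathbb N$. For $1\le p\le\infty$, $\ell^p$ is symmetrically finitely represented in $X$ if for every $n\in\mathbb N$ and $\varepsilon>0$ there exist pairwise disjointly supported $x_1,\dots,x_n\in X$, pairwise having the same ordered distribution, with $(1+\varepsilon)^{-1}\|a\|_p\le\|\sum_{k=1}^na_kx_k\|_X\le(1+\varepsilon)\|a\|_p$ for all $a\in\mathbb R^n$ ($\|\cdot\|_\infty$ being the max norm). $\mathcal F(X)$ is the set of all $p\in[1,\infty]$ such that $\ell^p$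 is symmetrically finitely represented in $X$. *)

(* Defs.v *)
(* Sequences are indexed by nat starting at 0
   (index k here corresponds to index k+1 in the paper). *)
From HB Require Import structures.
From mathcomp Require Import all_boot all_order all_algebra.
From mathcomp Require Import all_classical all_reals all_analysis.
Set Implicit Arguments. Unset Strict Implicit. Unset Printing Implicit Defensive.
Import Order.TTheory GRing.Theory Num.Theory numFieldNormedType.Exports.
Local Open Scope classical_set_scope.
Local Open Scope ring_scope.

Section SeqSpaces.
Variable R : realType.
Implicit Types (X : set (nat -> R)) (Nrm : (nat -> R) -> R) (u x y : nat -> R).

(* nonincreasing rearrangement u^* of (|u_k|), with values in \bar R:
   u^*_n = inf { s >= 0 | #{k : |u_k| > s} <= n }  (n = 0,1,2,...);
   for unbounded u this is +oo. *)
Definition rearr u (n : nat) : \bar R :=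
  ereal_inf [set s : \bar R | (0 <= s)%E /\
     exists l : seq nat, (size l <= n)%N /\ forall k, (s < (`|u k|)%:E)%E -> k \in l].

Definition banach_seq_space X Nrm :=
  (X (fun _ => 0)) /\
      (forall x y, X x -> X y -> X (fun k => x k + y k)) /\
      (forall (c : R) x, X x -> X (fun k => c * x k)) /\
      (forall x, X x -> 0 <= Nrm x) /\
      (forall x, X x -> Nrm x = 0 -> x = (fun _ => 0)) /\
      (forall (c : R) x, X x -> Nrm (fun k => c * x k) = `|c| * Nrm x) /\
      (forall x y, X x -> X y -> Nrm (fun k => x k + y k) <= Nrm x + Nrm y) /\
      (forall v : nat -> nat -> R, (forall i, X (v i)) ->
         (forall e : R, 0 < e -> exists M, forall i j, (M <= i)%N -> (M <= j)%N ->
              Nrm (fun k => v i k - v j k) < e) ->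
         exists x, X x /\ forall e : R, 0 < e -> exists M, forall i, (M <= i)%N ->
              Nrm (fun k => v i k - x k) < e).

Definition banach_seq_lattice X Nrm :=
  banach_seq_space X Nrm /\
  forall x y, X x -> (forall k, `|y k| <= `|x k|) -> X y /\ Nrm y <= Nrm x.

Definition bounded_seq u := exists M : R, forall k, `|u k| <= M.

Definition separable_seq_space X Nrm :=
  exists D : nat -> nat -> R, (forall i, X (D i)) /\
    forall x, X x -> forall e : R, 0 < e -> exists i, Nrm (fun k => x k - D i k) < e.

Definition fatou_property X Nrm :=
  forall (v : nat -> nat -> R) x, (forall i, X (v i)) ->
    (forall i k, 0 <= v i k <= v i.+1 k) ->
    (forall k, (fun i => v i k) @ \oo --> x k) ->
    (exists M : R, forall i, Nrm (v i) <= M) ->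
    X x /\ Nrm x = sup [set Nrm (v i) | i in [set: nat]].

Definition symmetric_seq_space X Nrm :=
  [/\ banach_seq_lattice X Nrm,
      (forall x, X x -> bounded_seq x),
      (forall x y, X x -> rearr y = rearr x -> X y /\ Nrm y = Nrm x) &
      (separable_seq_space X Nrm \/ fatou_property X Nrm)].

(* dilations (0-indexed versions of the paper's formulas) *)
Definition sigma_up (m : nat) (a : nat -> R) : nat -> R := fun n => a (n %/ m)%N.
Definition sigma_down (m : nat) (a : nat -> R) : nat -> R :=
  fun n => (m%:R)^-1 * \sum_(i < m) a (n * m + i)%N.

Definition opnorm X Nrm (T : (nat -> R) -> (nat -> R)) : R :=
  sup [set Nrm (T x) | x in [set x | X x /\ Nrm x <= 1]].

Definition boyd_alpha X Nrm : R :=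
  - limn (fun m : nat => ln (opnorm X Nrm (sigma_down m)) / ln (m%:R)).
Definition boyd_beta X Nrm : R :=
  limn (fun m : nat => ln (opnorm X Nrm (sigma_up m)) / ln (m%:R)).

Definition einv (a : R) : \bar R := if a == 0 then +oo%E else (a^-1)%:E.

Definition pnorm (p : \bar R) (n : nat) (a : 'I_n -> R) : R :=
  match p with
  | +oo%E => \big[Num.max/0]_(k < n) `|a k|
  | r%:E => (\sum_(k < n) `|a k| `^ r) `^ (r^-1)
  | -oo%E => 0
  end.

Definition same_ordered_distribution x y :=
  exists pi : nat -> nat, bijective pi /\ forall k, y (pi k) = x k.

Definition sym_fin_rep X Nrm (p : \bar R) :=
  forall (n : nat), (0 < n)%N -> forall eps : R, 0 < eps ->
  exists x : 'I_n -> nat -> R,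
    [/\ (forall i, X (x i)),
        (forall i j, i != j -> forall k, x i k = 0 \/ x j k = 0),
        (forall i j, same_ordered_distribution (x i) (x j)) &
        (forall a : 'I_n -> R,
           (1 + eps)^-1 * pnorm p a <= Nrm (fun k => \sum_(i < n) a i * x i k)
           <= (1 + eps) * pnorm p a)].

Definition calF X Nrm : set (\bar R) :=
  [set p | (1 <= p)%E /\ sym_fin_rep X Nrm p].

End SeqSpaces.

(* Main.v *)
Require Import Defs.
From HB Require Import structures.
From mathcomp Require Import all_boot all_order all_algebra.
From mathcomp Require Import all_classical all_reals all_analysis.
From mathcomp Require Import zify ring lra.
Import Order.TTheory GRing.Theory Num.Theory numFieldNormedType.Exports.
Local Open Scope classical_set_scope.
Local Open Scope ring_scope.

Set Implicit Arguments. Unset Strict Implicit. Unset Printing Implicit Defensive.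

(* The Boyd indices are read off the numbers ||sigma_m|| ~ m^beta and
   ||sigma_{1/m}|| ~ m^(-alpha). If disjoint equidistributed x_1, ..., x_n span a
   copy of l^p, then sum_i x_i is a rearrangement of sigma_n x_1, which forces
   alpha <= 1/p <= beta.

   Conversely let g be alpha or beta. For every M there is z >= 0 such that the
   norms of u_m = m^(-g) sigma_m z, m | M, are all equal to 1 up to a small power
   of M. Averaging the u_m over the products m = prod_j j^(k_j), j <= J, with
   weights q^|k_j - k0|, q < 1 close to 1, gives a vector x which sigma_j moves to
   j^g x up to a small relative error: positivity absorbs the change of the
   weights, and the boundary terms have weight q^k0. Disjoint copies of such an
   almost eigenvector span l^{1/g}: when |a_i|^{1/g} is close to m_i / Q, the sum of the
   a_i x_i is close to Q^(-g) times a rearrangement of sigma_{m_1 + ... + m_n} x. *)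

(** A vector nearly extremal for one dilation [sigma_M] need not behave well under the others.
    Submultiplicativity helps exactly at the divisors: if [M = d * m], a deficit at [m] would have
    to be repaired by [sigma_d], which cannot gain more than about [d^g]. This is why the averages
    run over products of powers, all dividing one [M], and not over an interval of integers. The
    price is a factor [C * M^eta] that grows with [M]. It is affordable because [eta] is fixed after
    the decay rate [kappa] of the weights ([q = exp (- kappa)]) and before the width [k0]: with
    [M = P^(2 k0 + 1)], where [P] is the product of the [j <= J], the squared loss is at most
    [exp ((2 k0 + 1) kappa / 4)], the number of products is polynomial in [k0], and the boundary
    weight [exp (- kappa k0)] beats both. No limit vector is taken: for given [n] and [eps], only
    finitely many dilations and a positive error have to be controlled. *)

Lemma divnMD_small u m i : (i < m)%N -> ((u * m + i) %/ m)%N = u.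
Proof. by move=> im; rewrite divnMDl ?divn_small ?addn0 //; lia. Qed.

Lemma modnMD_small u m i : (i < m)%N -> ((u * m + i) %% m)%N = i.
Proof. by move=> im; rewrite modnMDl modn_small. Qed.

Lemma divmod_inj n i j : (i %% n)%N = (j %% n)%N -> (i %/ n)%N = (j %/ n)%N -> i = j.
Proof. by move=> ij dij; rewrite (divn_eq i n) (divn_eq j n) ij dij. Qed.

(** * Rearrangements and injections between supports *)

Section Rearrangement.
Variable R : realType.
Implicit Types x y z : nat -> R.

(** The sets [|u_k| > s] with [s >= 0] lie in the support, so a value-preserving bijection of
    supports is enough. It need not extend to a permutation of the indices, and this lets a sequence
    be compared with a copy padded by infinitely many zeros. *)
Lemma rearr_inj (f : nat -> nat) x y :
  (forall i j, x i != 0 -> x j != 0 -> f i = f j -> i = j) ->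
  (forall i, x i != 0 -> y (f i) = x i) ->
  (forall j, y j != 0 -> exists2 i, x i != 0 & f i = j) ->
  rearr y = rearr x.
Proof.
move=> finj yf fsurj; apply/funext => n; rewrite /rearr; congr ereal_inf.
have nz (w : nat -> R) s k : (0 <= s)%E -> (s < (`|w k|)%:E)%E -> w k != 0.
  move=> s0 sw; apply/eqP => wk; move: sw.
  by rewrite wk normr0 ltNge s0.
have /choice[g gP] : forall j, exists i, y j != 0 -> x i != 0 /\ f i = j.
  move=> j.
  case: (boolP (y j == 0)) => [|/fsurj[i xi fi]]; first by exists 0%N.
  by exists i.
apply/seteqP; split => s /= [s0 [l [sl lP]]]; split => //.
- exists (map g l); split; first by rewrite size_map.
  move=> k sk; have xk := nz _ _ _ s0 sk.
  have yk : y (f k) != 0 by rewrite yf.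
  have [xg fg] := gP _ yk.
  apply/mapP; exists (f k); last exact/esym/finj.
  by apply: lP; rewrite yf.
- exists (map f l); split; first by rewrite size_map.
  move=> k sk; have yk := nz _ _ _ s0 sk.
  have [xg fg] := gP _ yk.
  apply/mapP; exists (g k) => //.
  by apply: lP; rewrite -yf // fg.
Qed.

(** Domination by a rearrangement of [y], with [f] unconstrained off the support of [x]. The norm
    inequalities coming from symmetry all go through this relation. *)
Definition dominated x y := exists f : nat -> nat,
  (forall i j, x i != 0 -> x j != 0 -> f i = f j -> i = j) /\
  (forall i, x i != 0 -> `|x i| <= `|y (f i)|).

(** The disjoint sum of [v 0], ..., [v n.-1], the [i]-th summand living on the indices congruent to
    [i] modulo [n]. *)
Definition spread (n : nat) (v : nat -> nat -> R) : nat -> R :=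
  fun k => v (k %% n)%N (k %/ n)%N.

End Rearrangement.

(** * Lattice and symmetry inequalities for the norm; dilations *)

Section SymmetricSpace.
Variables (R : realType) (X : set (nat -> R)) (Nrm : (nat -> R) -> R).
Hypothesis HX : symmetric_seq_space X Nrm.
Implicit Types x y z : nat -> R.

Lemma mem0 : X (fun=> 0).
Proof. by case: HX => [[[]]]. Qed.

Lemma memD x y : X x -> X y -> X (fun k => x k + y k).
Proof. by case: HX => [[[_ [+ _]]]] _ _ _ _; apply. Qed.

Lemma memZ (c : R) x : X x -> X (fun k => c * x k).
Proof. by case: HX => [[[_ [_ [+ _]]]]] _ _ _ _; apply. Qed.

Lemma memB x y : X x -> X y -> X (fun k => x k - y k).
Proof.
move=> Xx Xy; rewrite (_ : (fun k => _) = (fun k => x k + (-1) * y k)).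
  by apply: memD => //; apply: memZ.
by apply/funext => k; rewrite mulN1r.
Qed.

Lemma nrm_ge0 x : X x -> 0 <= Nrm x.
Proof. by case: HX => [[[_ [_ [_ [+ _]]]]]] _ _ _ _; apply. Qed.

Lemma nrm_eq0 x : X x -> Nrm x = 0 -> x = (fun=> 0).
Proof. by case: HX => [[[_ [_ [_ [_ [+ _]]]]]]] _ _ _ _; apply. Qed.

Lemma nrmZ (c : R) x : X x -> Nrm (fun k => c * x k) = `|c| * Nrm x.
Proof. by case: HX => [[[_ [_ [_ [_ [_ [+ _]]]]]]]] _ _ _ _; apply. Qed.

Lemma nrmD x y : X x -> X y -> Nrm (fun k => x k + y k) <= Nrm x + Nrm y.
Proof. by case: HX => [[[_ [_ [_ [_ [_ [_ [+ _]]]]]]]]] _ _ _ _; apply. Qed.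

Lemma nrm0 : Nrm (fun=> 0) = 0.
Proof.
by have := nrmZ 0 mem0; rewrite normr0 mul0r mul0r.
Qed.

Lemma mem_le x y : X y -> (forall k, `|x k| <= `|y k|) -> X x.
Proof. by move=> Xy xy; case: HX => [[_ H] _ _ _]; case: (H _ _ Xy xy). Qed.

Lemma nrm_le x y : X y -> (forall k, `|x k| <= `|y k|) -> Nrm x <= Nrm y.
Proof. by move=> Xy xy; case: HX => [[_ H] _ _ _]; case: (H _ _ Xy xy). Qed.

Lemma nrm_eq x y : X y -> (forall k, `|x k| = `|y k|) -> Nrm x = Nrm y.
Proof.
move=> Xy xy; apply/eqP; rewrite eq_le; apply/andP; split.
  by apply: nrm_le => // k; rewrite xy.
apply: nrm_le => [|k]; last by rewrite xy.
by apply: (mem_le Xy) => k; rewrite xy.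
Qed.

Lemma nrmBC x y : X x -> X y -> Nrm (fun k => x k - y k) = Nrm (fun k => y k - x k).
Proof. by move=> Xx Xy; apply: nrm_eq => [|k]; [exact: memB | exact: distrC]. Qed.

Lemma nrm_triB x y : X x -> X y -> Nrm x <= Nrm y + Nrm (fun k => x k - y k).
Proof.
move=> Xx Xy; apply: le_trans (nrmD Xy (memB Xx Xy)).
by rewrite (_ : (fun k => _) = x) //; apply/funext => k; ring.
Qed.

Lemma nrm_dist x y : X x -> X y -> `|Nrm x - Nrm y| <= Nrm (fun k => x k - y k).
Proof.
move=> Xx Xy; have := nrm_triB Xx Xy; have := nrm_triB Xy Xx.
by rewrite (nrmBC Xy Xx) ler_norml; lra.
Qed.

Lemma mem_sum (I : Type) (s : seq I) (F : I -> nat -> R) :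
  (forall i, X (F i)) -> X (fun k => \sum_(i <- s) F i k).
Proof.
move=> XF; elim: s => [|i s IH].
  by rewrite (_ : (fun k => _) = (fun=> 0)); [exact: mem0 | apply/funext => k; rewrite big_nil].
rewrite (_ : (fun k => _) = (fun k => F i k + \sum_(j <- s) F j k)); first exact: memD.
by apply/funext => k; rewrite big_cons.
Qed.

Lemma nrm_sum (I : Type) (s : seq I) (F : I -> nat -> R) :
  (forall i, X (F i)) ->
  Nrm (fun k => \sum_(i <- s) F i k) <= \sum_(i <- s) Nrm (F i).
Proof.
move=> XF; elim: s => [|i s IH].
  rewrite big_nil (_ : (fun k => _) = (fun=> 0)) ?nrm0 //.
  by apply/funext => k; rewrite big_nil.
rewrite (_ : (fun k => _) = (fun k => F i k + \sum_(j <- s) F j k)); last first.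
  by apply/funext => k; rewrite big_cons.
apply: le_trans (nrmD _ _) _ => //; first exact: mem_sum.
by rewrite big_cons lerD2l.
Qed.

Lemma dominatedP x y : X y -> dominated x y -> X x /\ Nrm x <= Nrm y.
Proof.
move=> Xy [f [finj fle]].
(* [x'] is [x] transported along [f] and extended by 0. It lies below [y] pointwise, where the
   lattice property applies, and has the rearrangement of [x], where symmetry applies. *)
have /choice[x' x'P] : forall j, exists r,
    (exists i, [/\ x i != 0, f i = j & r = x i]) \/
    ((forall i, x i != 0 -> f i <> j) /\ r = 0).
  move=> j.
  have [[i [xi fi]]|H] := pselect (exists i, x i != 0 /\ f i = j).
    by exists (x i); left; exists i.
  by exists 0; right; split=> // i xi fi; apply: H; exists i.
have x'y j : `|x' j| <= `|y j|.
  have [[i [xi <- ->]]|[_ ->]] := x'P j; first exact: fle.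
  by rewrite normr0.
have rx : rearr x = rearr x'.
  apply/esym/(@rearr_inj _ f) => // [i xi|j].
    have [[k [xk fk ->]]|[H _]] := x'P (f i); first by rewrite (finj _ _ xk xi fk).
    by case: (H i).
  have [[i [xi fi xj]]|[_ ->]] := x'P j; last by rewrite eqxx.
  by exists i.
have Xx' := mem_le Xy x'y.
case: HX => _ _ H _; have [Xx ->] := H _ _ Xx' rx.
by split=> //; exact: nrm_le.
Qed.

Lemma mem_dom x y : X y -> dominated x y -> X x.
Proof. by move=> Xy xy; case: (dominatedP Xy xy). Qed.

Lemma nrm_dom x y : X y -> dominated x y -> Nrm x <= Nrm y.
Proof. by move=> Xy xy; case: (dominatedP Xy xy). Qed.

Lemma dom_spread_slot n i x : (i < n)%N ->
  dominated (spread n (fun j k => if j == i then x k else 0)) x.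
Proof.
move=> ilt; exists (fun k => (k %/ n)%N); split => [k l|k].
  rewrite /spread; case: (_ %% _ =P i)%N => [ki|_]; last by rewrite eqxx.
  case: (_ %% _ =P i)%N => [li|_]; last by rewrite eqxx.
  by move=> _ _; apply: divmod_inj; rewrite ki li.
by rewrite /spread; case: (_ %% _ =P i)%N => // _; rewrite eqxx.
Qed.

Lemma spreadE n (v : nat -> nat -> R) : (0 < n)%N ->
  spread n v = fun k => \sum_(i < n) spread n (fun j l => if j == i then v i l else 0) k.
Proof.
move=> n0; apply/funext => k; rewrite /spread.
have kn : (k %% n < n)%N by rewrite ltn_mod.
rewrite (bigD1 (Ordinal kn)) //= eqxx big1 ?addr0 // => i.
by rewrite -val_eqE /= eq_sym; case: eqP.
Qed.

Lemma mem_spread n v : (0 < n)%N -> (forall i, (i < n)%N -> X (v i)) ->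
  X (spread n v).
Proof.
move=> n0 Xv; rewrite spreadE //; apply: mem_sum => i.
by apply: (mem_dom (Xv i _)) => //; apply: dom_spread_slot.
Qed.

Lemma nrm_spread n v : (0 < n)%N -> (forall i, (i < n)%N -> X (v i)) ->
  Nrm (spread n v) <= \sum_(i < n) Nrm (v i).
Proof.
move=> n0 Xv; rewrite spreadE //; apply: le_trans (nrm_sum _ _) _ => [i|].
  by apply: (mem_dom (Xv i _)) => //; apply: dom_spread_slot.
by apply: ler_sum => i _; apply: (nrm_dom (Xv i _)) => //; apply: dom_spread_slot.
Qed.

Lemma nrm_spread_dist n v w : (0 < n)%N ->
  (forall i, (i < n)%N -> X (v i)) -> (forall i, (i < n)%N -> X (w i)) ->
  `|Nrm (spread n v) - Nrm (spread n w)| <= \sum_(i < n) Nrm (fun k => v i k - w i k).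
Proof.
move=> n0 Xv Xw; apply: le_trans (nrm_dist _ _) _; try exact: mem_spread.
apply: le_trans (@nrm_spread n (fun i k => v i k - w i k) n0 _) _ => // i ilt.
by apply: memB; [exact: Xv|exact: Xw].
Qed.

Lemma dom_slot n i (v : nat -> nat -> R) : (i < n)%N -> dominated (v i) (spread n v).
Proof.
move=> ilt; exists (fun k => k * n + i)%N; split => [k l _ _ /addIn /eqP|k _].
  by rewrite eqn_pmul2r; [move/eqP | lia].
by rewrite /spread modnMD_small // divnMD_small.
Qed.

Lemma sigma_up_spread n x : sigma_up n x = spread n (fun=> x).
Proof. by []. Qed.

Lemma mem_up m x : (0 < m)%N -> X x -> X (sigma_up m x).
Proof. by move=> m0 Xx; rewrite sigma_up_spread; apply: mem_spread. Qed.

Lemma nrm_up_le m x : (0 < m)%N -> X x -> Nrm (sigma_up m x) <= m%:R * Nrm x.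
Proof.
move=> m0 Xx; rewrite sigma_up_spread; apply: le_trans (nrm_spread _ _) _ => //.
by rewrite sumr_const card_ord mulr_natl.
Qed.

Lemma nrm_up_ge m x : (0 < m)%N -> X x -> Nrm x <= Nrm (sigma_up m x).
Proof.
move=> m0 Xx; apply: nrm_dom; first exact: mem_up.
by rewrite sigma_up_spread; apply: (@dom_slot m 0%N (fun=> x)).
Qed.

Lemma nrm_up_mono m m' x : (0 < m <= m')%N -> X x ->
  Nrm (sigma_up m x) <= Nrm (sigma_up m' x).
Proof.
move=> /andP[m0 mm'] Xx; apply: nrm_dom; first by apply: mem_up => //; lia.
have km k : (k %% m < m')%N by apply: leq_trans mm'; rewrite ltn_mod.
exists (fun k => (k %/ m) * m' + k %% m)%N; split => [k l _ _ kl|k _].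
  have := congr1 (fun i => i %% m')%N kl; rewrite !modnMD_small //.
  have := congr1 (fun i => i %/ m')%N kl; rewrite !divnMD_small //.
  by move=> d r; apply: divmod_inj r d.
by rewrite /sigma_up divnMD_small.
Qed.

Lemma sigma_upM m n x : sigma_up m (sigma_up n x) = sigma_up (m * n) x.
Proof. by apply/funext => k; rewrite /sigma_up divnMA. Qed.

Lemma sigma_downK m x : (0 < m)%N -> sigma_down m (sigma_up m x) = x.
Proof.
move=> m0; apply/funext => k; rewrite /sigma_down /sigma_up.
rewrite (eq_bigr (fun=> x k)) => [|i _]; last by rewrite divnMD_small.
by rewrite sumr_const card_ord -[x k *+ m]mulr_natl mulKf // pnatr_eq0; lia.
Qed.

Lemma dom_section m i x : (i < m)%N -> dominated (fun k => x (k * m + i)%N) x.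
Proof.
move=> im; exists (fun k => k * m + i)%N; split=> // k l _ _ /addIn /eqP.
by rewrite eqn_pmul2r; [move/eqP | lia].
Qed.

Lemma mem_down m x : X x -> X (sigma_down m x).
Proof.
move=> Xx; apply: memZ; apply: (@mem_sum _ _ (fun i : 'I_m => fun k => x (k * m + i)%N)) => i.
exact/(mem_dom Xx)/dom_section.
Qed.

Lemma sum_le_cst (m : nat) (F : 'I_m -> R) (c : R) : (0 < m)%N -> (forall i, F i <= c) ->
  m%:R^-1 * \sum_(i < m) F i <= c.
Proof.
move=> m0 Fc; rewrite mulrC ler_pdivrMr ?ltr0n //.
apply: le_trans (ler_sum _ (fun i _ => Fc i)) _.
by rewrite sumr_const card_ord mulr_natr.
Qed.

Lemma nrm_down_le m x : (0 < m)%N -> X x -> Nrm (sigma_down m x) <= Nrm x.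
Proof.
move=> m0 Xx.
have Xi (i : 'I_m) : X (fun k => x (k * m + i)%N) by exact/(mem_dom Xx)/dom_section.
rewrite nrmZ; last exact: (@mem_sum _ _ (fun i : 'I_m => fun k => x (k * m + i)%N)).
rewrite ger0_norm ?invr_ge0 ?ler0n //.
apply: le_trans (sum_le_cst (F := fun i => Nrm (fun k => x (k * m + i)%N)) m0 _) => [|i].
  rewrite ler_pM2l ?invr_gt0 ?ltr0n //.
  exact: (nrm_sum _ Xi).
exact/(nrm_dom Xx)/dom_section.
Qed.

(* The block average [sigma_m sigma_{1/m} y] is the mean of the [m] cyclic
   rotations of [y] inside the blocks, hence a contraction. *)
Lemma nrm_up_down m x : (0 < m)%N -> X x -> Nrm (sigma_up m (sigma_down m x)) <= Nrm x.
Proof.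
move=> m0 Xx.
pose rot (r : 'I_m) k := x ((k %/ m) * m + (k %% m + r) %% m)%N.
have drot r : dominated (rot r) x.
  exists (fun k => (k %/ m) * m + (k %% m + r) %% m)%N; split=> // k l _ _ kl.
  have := congr1 (fun i => i %% m)%N kl; rewrite !modnMDl !modn_mod => /eqP.
  rewrite eqn_modDr !modn_mod => /eqP r1.
  have := congr1 (fun i => i %/ m)%N kl.
  rewrite !divnMD_small ?ltn_mod // => d1.
  exact: divmod_inj r1 d1.
have -> : sigma_up m (sigma_down m x) = fun k => m%:R^-1 * \sum_(r < m) rot r k.
  apply/funext => k; rewrite /sigma_up /sigma_down /rot; congr (_ * _).
  pose h (r : 'I_m) : 'I_m := Ordinal (ltn_pmod (k %% m + r) m0).
  have hinj : injective h.
    move=> r r' /(congr1 val) /= /eqP; rewrite eqn_modDl => /eqP.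
    by rewrite !modn_small // => /val_inj.
  by rewrite (reindex_inj hinj).
rewrite nrmZ; last by apply: mem_sum => r; exact/(mem_dom Xx).
rewrite ger0_norm ?invr_ge0 ?ler0n //.
apply: le_trans (sum_le_cst (F := fun i => Nrm (rot i)) m0 _) => [|i].
  rewrite ler_pM2l ?invr_gt0 ?ltr0n //.
  by apply: nrm_sum => r; exact/(mem_dom Xx).
exact/(nrm_dom Xx)/drot.
Qed.

Lemma sigma_downM m n x : (0 < m)%N -> (0 < n)%N ->
  sigma_down (m * n) x = sigma_down m (sigma_down n x).
Proof.
move=> m0 n0; apply/funext => k; rewrite /sigma_down.
rewrite natrM invfM -mulrA -mulr_sumr; congr (_ * (_ * _)).
rewrite pair_big /=.
have ltp (p : 'I_m * 'I_n) : (p.1 * n + p.2 < m * n)%N by case: p => -[i im] [j jn] /=; nia.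
have ltd (i : 'I_(m * n)) : (i %/ n < m)%N by rewrite ltn_divLR.
have ltm (i : 'I_(m * n)) : (i %% n < n)%N by rewrite ltn_mod.
rewrite (reindex (fun p : 'I_m * 'I_n => Ordinal (ltp p))) /=.
  by apply: eq_bigr => -[[i im] [j jn]] _ /=; congr x; nia.
exists (fun i => (Ordinal (ltd i), Ordinal (ltm i))) => [[[i im] [j jn]]|i] _ /=.
  congr pair; apply: val_inj => /=; first by rewrite divnMD_small.
  by rewrite modnMD_small.
by apply: val_inj; rewrite /= -divn_eq.
Qed.

End SymmetricSpace.

(** * Growth exponents of submultiplicative functions *)

Section LogarithmicGrowth.
Variable R : realType.
Implicit Types h : nat -> R.

Lemma ln_nat_gt0 m : (1 < m)%N -> 0 < ln (m%:R : R).
Proof. by move=> m1; rewrite ln_gt0 ?ltr1n. Qed.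

Lemma ln_nat_ge0 m : 0 <= ln (m%:R : R).
Proof. by case: m => [|m]; [rewrite ln0 | rewrite ln_ge0 // ler1n]. Qed.

Lemma ln_natX d k : (0 < d)%N -> ln ((d ^ k)%:R : R) = k%:R * ln (d%:R).
Proof. by move=> d0; rewrite natrX lnXn ?ltr0n // mulr_natl. Qed.

Lemma ler_ln_nat m n : (0 < m <= n)%N -> ln (m%:R : R) <= ln n%:R.
Proof. by move=> /andP[m0 mn]; rewrite ler_ln ?posrE ?ltr0n ?ler_nat //; lia. Qed.

(** Fekete's argument: the first hypothesis puts the upper limit of [h m / ln m] below each single
    ratio [h d / ln d], so the ratios converge to their infimum, which [K] keeps finite. Since the
    limit is an infimum, the lower bound holds for every [m] without loss. *)
Lemma growth_limit h :
  (forall d, (1 < d)%N -> exists C, forall m, (0 < m)%N ->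
     h m <= h d / ln d%:R * ln m%:R + C) ->
  (exists K, forall m, (0 < m)%N -> K * ln m%:R <= h m) ->
  let rho := limn (fun m => h m / ln m%:R) in
  (forall m, (0 < m)%N -> rho * ln m%:R <= h m) /\
  (forall eta, 0 < eta -> exists C, forall m, (0 < m)%N ->
     h m <= (rho + eta) * ln m%:R + C).
Proof.
move=> hub [K hlb] rho.
pose E := [set h m / ln m%:R | m in [set m | (1 < m)%N]].
have Elb : lbound E K.
  by move=> _ [m /= m1 <-]; rewrite ler_pdivlMr ?ln_nat_gt0 // hlb //; lia.
have E0 : E !=set0 by exists (h 2 / ln 2%:R); exists 2.
have close eta : 0 < eta -> exists C, forall m, (0 < m)%N ->
     h m <= (inf E + eta) * ln m%:R + C.
  move=> eta0.
  have [_ [d /= d1 <-] dlt] := inf_adherent eta0 (conj E0 (ex_intro _ _ Elb)).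
  have [C hC] := hub d d1; exists C => m m0.
  apply: le_trans (hC m m0) _; rewrite lerD2r ler_wpM2r ?ln_nat_ge0 //.
  exact: ltW.
have low m : (1 < m)%N -> inf E <= h m / ln m%:R.
  by move=> m1; apply: ge_inf; [exists K | exists m].
suff -> : rho = inf E.
  split=> [m m0|eta eta0]; last exact: close.
  case: (ltnP 1 m) => [m1|m1]; first by rewrite -ler_pdivlMr ?ln_nat_gt0 // low.
  have -> : m = 1%N by lia.
  by rewrite ln1 mulr0; apply: le_trans (hlb 1%N isT); rewrite ln1 mulr0.
apply/cvg_lim => //; apply/cvgrPdist_le => eps eps0.
have e2 : 0 < eps / 2 by rewrite divr_gt0.
have [C hC] := close _ e2.
near=> m.
have m1 : (1 < m)%N by near: m; exact: nbhs_infty_gt.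
have L0 := ln_nat_gt0 m1.
rewrite distrC ger0_norm ?subr_ge0 ?low // lerBlDl ler_pdivrMr //.
apply: le_trans (hC m _) _; first lia.
suff : C <= eps / 2 * ln m%:R by lra.
(* The constant [C] is absorbed once [m] exceeds the exponential of [2 C / eps]. *)
rewrite -ler_pdivrMl // -[leLHS]expRK ler_ln ?posrE ?expR_gt0 ?ltr0n //; last lia.
near: m; exact: nbhs_infty_ger.
Unshelve. all: by end_near.
Qed.

Lemma trunc_log_ln d m : (1 < d)%N -> (0 < m)%N ->
  (trunc_log d m)%:R * ln d%:R <= ln (m%:R : R) <= (trunc_log d m).+1%:R * ln d%:R.
Proof.
move=> d1 m0; have /andP[lo hi] := trunc_log_bounds d1 m0.
have d0 : (0 < d)%N by lia.
by rewrite -!ln_natX // !ler_ln_nat // ?expn_gt0 ?d0 ?lo //; lia.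
Qed.

Lemma submul_pow h d k : (0 < d)%N -> h 1%N <= 0 ->
  (forall m n, (0 < m)%N -> (0 < n)%N -> h (m * n)%N <= h m + h n) ->
  h (d ^ k)%N <= k%:R * h d.
Proof.
move=> d0 h1 hM; elim: k => [|k IH]; first by rewrite expn0 mul0r.
rewrite expnS; apply: le_trans (hM _ _ d0 _) _; first by rewrite expn_gt0 d0.
by rewrite -natr1 mulrDl mul1r addrC lerD2r.
Qed.

(** With [k = trunc_log d m], monotonicity compares [m] with the power [d^(k+1)] above it; the extra
    factor [d] costs [h d]. *)
Lemma growth_nondecreasing h :
  (forall m n, (0 < m)%N -> (0 < n)%N -> h (m * n)%N <= h m + h n) ->
  (forall m n, (0 < m <= n)%N -> h m <= h n) -> h 1%N = 0 ->
  forall d, (1 < d)%N -> exists C, forall m, (0 < m)%N ->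
     h m <= h d / ln d%:R * ln m%:R + C.
Proof.
move=> hM hmono h1 d d1; exists (h d) => m m0.
have /andP[lo hi] := trunc_log_bounds d1 m0.
have /andP[lo' _] := trunc_log_ln d1 m0.
have d0 : (0 < d)%N by lia.
apply: le_trans (hmono _ (d ^ (trunc_log d m).+1)%N _) _; first by rewrite m0 ltnW.
apply: le_trans (submul_pow _ d0 _ hM) _; first by rewrite h1.
rewrite -natr1 mulrDl mul1r lerD2r mulrC -mulrA ler_wpM2l //.
  by rewrite -h1 hmono //; lia.
by rewrite mulrC ler_pdivlMr ?ln_nat_gt0.
Qed.

(** Here the power [d^k] below [m] is used. As [h d <= 0], a lower bound on [k] is needed, and the
    lost unit costs [- h d]. *)
Lemma growth_nonincreasing h :
  (forall m n, (0 < m)%N -> (0 < n)%N -> h (m * n)%N <= h m + h n) ->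
  (forall m n, (0 < m <= n)%N -> h n <= h m) -> h 1%N = 0 ->
  forall d, (1 < d)%N -> exists C, forall m, (0 < m)%N ->
     h m <= h d / ln d%:R * ln m%:R + C.
Proof.
move=> hM hmono h1 d d1; exists (- h d) => m m0.
have /andP[lo hi] := trunc_log_bounds d1 m0.
have /andP[_] := trunc_log_ln d1 m0; rewrite -natr1 mulrDl mul1r => hi'.
have d0 : (0 < d)%N by lia.
apply: le_trans (hmono (d ^ trunc_log d m)%N _ _) _; first by rewrite expn_gt0 d0 lo.
apply: le_trans (submul_pow _ d0 _ hM) _; first by rewrite h1.
have hd0 : h d <= 0 by rewrite -h1 hmono //; lia.
rewrite mulrC -mulrA -[X in _ + X]mulrN1 -mulrDr ler_wnM2l // lerBlDr.
by rewrite mulrC ler_pdivrMr ?ln_nat_gt0 // mulrDl mul1r.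
Qed.

End LogarithmicGrowth.

(** * Operator norms of the dilations and the Boyd exponents *)

Section OperatorNorms.
Variables (R : realType) (X : set (nat -> R)) (Nrm : (nat -> R) -> R).
Hypothesis HX : symmetric_seq_space X Nrm.
Hypothesis X_neq0 : exists x, X x /\ x <> (fun=> 0).
Implicit Types x y z : nat -> R.

Lemma exists_unit : exists2 x, X x & Nrm x = 1.
Proof.
have [x [Xx xn0]] := X_neq0.
have x0 : Nrm x != 0 by apply/eqP => /(nrm_eq0 HX Xx).
exists (fun k => (Nrm x)^-1 * x k); first exact: (memZ HX).
rewrite (nrmZ HX) // ger0_norm ?mulVf // invr_ge0; exact: (nrm_ge0 HX).
Qed.

Section Generic.
Variables (T : (nat -> R) -> nat -> R) (K : R).
Hypothesis K0 : 0 <= K.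
Hypothesis TX : forall x, X x -> X (T x).
Hypothesis TZ : forall c x, T (fun k => c * x k) = fun k => c * T x k.
Hypothesis TK : forall x, X x -> Nrm (T x) <= K * Nrm x.

Let E := [set Nrm (T x) | x in [set x | X x /\ Nrm x <= 1]].

(** [sup] takes a default value on unbounded sets; the a priori bound [K] makes [opnorm] a genuine
    supremum. *)
Lemma opnorm_has_sup : has_sup E.
Proof.
split.
  exists (Nrm (T (fun=> 0))), (fun=> 0) => //=.
  by split; rewrite ?(nrm0 HX) //; exact: (mem0 HX).
exists K => _ [x /= [Xx x1] <-]; apply: le_trans (TK Xx) _.
by rewrite -[leRHS]mulr1 ler_wpM2l.
Qed.

Lemma opnorm_ub x : X x -> Nrm (T x) <= opnorm X Nrm T * Nrm x.
Proof.
move=> Xx; have := nrm_ge0 HX Xx; rewrite le_eqVlt => /orP[/eqP x0|x0].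
  by have := TK Xx; rewrite -x0 !mulr0.
pose y := fun k => (Nrm x)^-1 * x k.
have Ty : Nrm (T y) = (Nrm x)^-1 * Nrm (T x).
  by rewrite TZ (nrmZ HX) ?ger0_norm ?invr_ge0 ?ltW //; exact: TX.
rewrite -ler_pdivrMr // mulrC -Ty.
apply: ub_le_sup; first by case: opnorm_has_sup.
exists y => //=; split; first exact: (memZ HX).
by rewrite (nrmZ HX) // ger0_norm ?invr_ge0 ?(ltW x0) // mulVf ?gt_eqF.
Qed.

Lemma opnorm_le c : 0 <= c -> (forall x, X x -> Nrm (T x) <= c * Nrm x) ->
  opnorm X Nrm T <= c.
Proof.
move=> c0 Tc; apply: ge_sup; first by case: opnorm_has_sup.
move=> _ [x /= [Xx x1] <-]; apply: le_trans (Tc _ Xx) _.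
by rewrite -[leRHS]mulr1 ler_wpM2l.
Qed.

Lemma opnorm_adherent : 0 < opnorm X Nrm T ->
  exists x, [/\ X x, Nrm x <= 1 & opnorm X Nrm T / 2 <= Nrm (T x)].
Proof.
move=> T0; have e0 : 0 < opnorm X Nrm T / 2 by rewrite divr_gt0.
have [_ [x /= [Xx x1] <-] lt] := sup_adherent e0 opnorm_has_sup.
exists x; split=> //; apply: ltW; apply: le_lt_trans lt.
by rewrite -/(opnorm X Nrm T); lra.
Qed.

End Generic.

Local Notation b m := (opnorm X Nrm (sigma_up m)).
Local Notation a m := (opnorm X Nrm (sigma_down m)).

Lemma sigma_upZ m c x : sigma_up m (fun k => c * x k) = fun k => c * sigma_up m x k.
Proof. by []. Qed.

Lemma sigma_downZ m c x :
  sigma_down m (fun k => c * x k) = fun k => c * sigma_down m x k.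
Proof. by apply/funext => k; rewrite /sigma_down -mulr_sumr mulrCA. Qed.

Lemma up_ub m x : (0 < m)%N -> X x -> Nrm (sigma_up m x) <= b m * Nrm x.
Proof.
move=> m0; apply: (@opnorm_ub _ m%:R) => // y Xy; first exact: (mem_up HX).
exact: (nrm_up_le HX).
Qed.

Lemma up_le m c : (0 < m)%N -> 0 <= c ->
  (forall x, X x -> Nrm (sigma_up m x) <= c * Nrm x) -> b m <= c.
Proof.
by move=> m0; apply: (@opnorm_le _ m%:R) => // y Xy; exact: (nrm_up_le HX).
Qed.

Lemma down_ub m x : (0 < m)%N -> X x -> Nrm (sigma_down m x) <= a m * Nrm x.
Proof.
move=> m0; apply: (@opnorm_ub _ 1) => // [y Xy|c y|y Xy].
- exact: (mem_down HX).
- exact: sigma_downZ.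
- by rewrite mul1r; exact: (nrm_down_le HX).
Qed.

Lemma down_le m c : (0 < m)%N -> 0 <= c ->
  (forall x, X x -> Nrm (sigma_down m x) <= c * Nrm x) -> a m <= c.
Proof.
move=> m0; apply: (@opnorm_le _ 1) => // y Xy.
by rewrite mul1r; exact: (nrm_down_le HX).
Qed.

Lemma up_ge1 m : (0 < m)%N -> 1 <= b m.
Proof.
move=> m0; have [x Xx x1] := exists_unit.
by have := up_ub m0 Xx; have := nrm_up_ge HX m0 Xx; rewrite x1; lra.
Qed.

Lemma up_adherent m : (0 < m)%N ->
  exists x, [/\ X x, Nrm x <= 1 & b m / 2 <= Nrm (sigma_up m x)].
Proof.
move=> m0; apply: (@opnorm_adherent _ m%:R) => [|x Xx|]; first exact: ler0n.
  exact: (nrm_up_le HX).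
by apply: lt_le_trans (up_ge1 m0).
Qed.

Lemma up_leM m n : (0 < m)%N -> (0 < n)%N -> b (m * n) <= b m * b n.
Proof.
move=> m0 n0; have bm := up_ge1 m0; have bn := up_ge1 n0.
apply: up_le; [by rewrite muln_gt0 m0|nra|move=> x Xx].
rewrite -sigma_upM; apply: le_trans (up_ub m0 (mem_up HX n0 Xx)) _.
by rewrite -mulrA ler_wpM2l ?up_ub //; lra.
Qed.

Lemma up_mono m n : (0 < m <= n)%N -> b m <= b n.
Proof.
move=> mn; have n0 : (0 < n)%N by lia.
apply: up_le => [||x Xx]; first lia; first by have := up_ge1 n0; lra.
by apply: le_trans (nrm_up_mono HX mn Xx) _; exact: up_ub.
Qed.

Lemma up_le_nat m : (0 < m)%N -> b m <= m%:R.
Proof. by move=> m0; apply: up_le => // x Xx; exact: (nrm_up_le HX). Qed.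

(** As [sigma_{1/m}] is a left inverse of [sigma_m], its norm controls how little [sigma_m] can
    expand. Through this inequality alpha becomes a lower exponent for the dilations. *)
Lemma down_lb m x : (0 < m)%N -> X x -> Nrm x <= a m * Nrm (sigma_up m x).
Proof.
move=> m0 Xx; rewrite -[in leLHS](sigma_downK x m0).
by apply: down_ub => //; exact: (mem_up HX).
Qed.

Lemma down_ge_inv m : (0 < m)%N -> m%:R^-1 <= a m.
Proof.
move=> m0; have [x Xx x1] := exists_unit.
have xlo := nrm_up_ge HX m0 Xx; rewrite x1 in xlo.
have xup := nrm_up_le HX m0 Xx; rewrite x1 mulr1 in xup.
have xa := down_lb m0 Xx; rewrite x1 in xa.
rewrite -(div1r m%:R) ler_pdivrMr ?ltr0n //; nra.
Qed.

Lemma down_gt0 m : (0 < m)%N -> 0 < a m.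
Proof. by move=> m0; apply: lt_le_trans (down_ge_inv m0); rewrite invr_gt0 ltr0n. Qed.

Lemma down_adherent m : (0 < m)%N ->
  exists x, [/\ X x, Nrm x <= 1 & a m / 2 <= Nrm (sigma_down m x)].
Proof.
move=> m0; apply: (@opnorm_adherent _ 1) => // [x Xx|]; last exact: down_gt0.
by rewrite mul1r; exact: (nrm_down_le HX).
Qed.

Lemma down_leM m n : (0 < m)%N -> (0 < n)%N -> a (m * n) <= a m * a n.
Proof.
move=> m0 n0; have am := down_gt0 m0; have an := down_gt0 n0.
apply: down_le; [by rewrite muln_gt0 m0|nra|move=> x Xx].
rewrite sigma_downM //; apply: le_trans (down_ub m0 (mem_down HX n Xx)) _.
by rewrite -mulrA ler_wpM2l ?down_ub //; lra.
Qed.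

(** Averages over blocks of different lengths are not compared pointwise. The vector [sigma_{1/n} x]
    is dilated by [m], then the dilation is enlarged to [n], where the block average is a
    contraction. *)
Lemma down_mono m n : (0 < m <= n)%N -> a n <= a m.
Proof.
move=> mn; have n0 : (0 < n)%N by lia.
have m0 : (0 < m)%N by lia.
apply: down_le => // [|x Xx]; first exact/ltW/down_gt0.
apply: le_trans (down_lb m0 (mem_down HX n Xx)) _.
rewrite ler_wpM2l ?(ltW (down_gt0 m0)) //.
apply: le_trans (nrm_up_mono HX mn (mem_down HX n Xx)) _.
exact: (nrm_up_down HX).
Qed.

Lemma down_le1 m : (0 < m)%N -> a m <= 1.
Proof. by move=> m0; apply: down_le => // x Xx; rewrite mul1r; exact: (nrm_down_le HX). Qed.

Let beta := boyd_beta X Nrm.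
Let alpha := boyd_alpha X Nrm.

Lemma lnD_le (u v w : R) : 0 < u -> 0 < v -> 0 < w -> u <= v * w -> ln u <= ln v + ln w.
Proof. by move=> u0 v0 w0 uvw; rewrite -lnM ?posrE // ler_ln ?posrE // mulr_gt0. Qed.

Lemma ln_leD (u s t C : R) : 0 < u -> 0 < s -> ln u <= t * ln s + C -> u <= expR C * s `^ t.
Proof.
move=> u0 s0 h; rewrite -[u]lnK ?posrE // /powR gt_eqF // -expRD ler_expR; lra.
Qed.

Lemma up_gt0 m : (0 < m)%N -> 0 < b m.
Proof. by move=> m0; apply: lt_le_trans (up_ge1 m0). Qed.

Lemma beta_growth :
  (forall m, (0 < m)%N -> m%:R `^ beta <= b m) /\
  (forall eta, 0 < eta -> exists2 C, 0 < C & forall m, (0 < m)%N ->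
     b m <= C * m%:R `^ (beta + eta)).
Proof.
have b1 : ln (b 1%N) = 0.
  by apply/eqP; rewrite eq_le ln_ge0 ?up_ge1 // andbT ln_le0 // up_le_nat.
have [||lo hi] := @growth_limit R (fun m => ln (b m)).
- apply: growth_nondecreasing => // [m n m0 n0|m n mn].
  + by apply: lnD_le; rewrite ?up_gt0 ?muln_gt0 ?m0 //; exact: up_leM.
  + by rewrite ler_ln ?posrE ?up_mono ?up_gt0 //; lia.
- by exists 0 => m m0; rewrite mul0r ln_ge0 // up_ge1.
split=> [m m0|eta /hi[C hC]].
  rewrite /powR gt_eqF ?ltr0n // -[leRHS]lnK ?posrE ?up_gt0 // ler_expR.
  exact: lo.
exists (expR C); first exact: expR_gt0.
by move=> m m0; apply: ln_leD; rewrite ?up_gt0 ?ltr0n //; exact: hC.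
Qed.

Lemma alpha_growth :
  (forall m, (0 < m)%N -> m%:R `^ (- alpha) <= a m) /\
  (forall eta, 0 < eta -> exists2 C, 0 < C & forall m, (0 < m)%N ->
     a m <= C * m%:R `^ (- alpha + eta)).
Proof.
have a1 : ln (a 1%N) = 0.
  apply/eqP; rewrite eq_le ln_le0 ?down_le1 //= ln_ge0 //.
  by apply: le_trans (down_ge_inv _) => //; rewrite invr1.
have [||lo hi] := @growth_limit R (fun m => ln (a m)).
- apply: growth_nonincreasing => // [m n m0 n0|m n mn].
  + by apply: lnD_le; rewrite ?down_gt0 ?muln_gt0 ?m0 //; exact: down_leM.
  + by rewrite ler_ln ?posrE ?down_mono ?down_gt0 //; lia.
- exists (-1) => m m0; rewrite mulN1r -lnV ?posrE ?ltr0n //.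
  by rewrite ler_ln ?posrE ?invr_gt0 ?ltr0n ?down_gt0 // down_ge_inv.
rewrite /alpha /boyd_alpha opprK.
split=> [m m0|eta /hi[C hC]].
  rewrite /powR gt_eqF ?ltr0n // -[leRHS]lnK ?posrE ?down_gt0 // ler_expR.
  exact: lo.
exists (expR C); first exact: expR_gt0.
by move=> m m0; apply: ln_leD; rewrite ?down_gt0 ?ltr0n //; exact: hC.
Qed.

End OperatorNorms.

(** * Vectors whose dilations grow like a power on the divisors of [M] *)

Section AlmostPower.
Variables (R : realType) (X : set (nat -> R)) (Nrm : (nat -> R) -> R).
Hypothesis HX : symmetric_seq_space X Nrm.
Hypothesis X_neq0 : exists x, X x /\ x <> (fun=> 0).
Implicit Types x y z : nat -> R.

Lemma mem_abs x : X x -> X (fun k => `|x k|).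
Proof. by move=> Xx; apply: (mem_le HX Xx) => k; rewrite normr_id. Qed.

Lemma nrm_abs x : X x -> Nrm (fun k => `|x k|) = Nrm x.
Proof. by move=> Xx; apply: (nrm_eq HX Xx) => k; rewrite normr_id. Qed.

(* On the divisors [m] of any prescribed [M], the norms of [sigma_m z] can be
   made equal to [m^g], up to a factor which is subpolynomial in [M]. *)
Definition almost_power (g : R) := forall eta : R, 0 < eta -> exists2 C : R, 0 < C &
  forall M, (0 < M)%N -> exists z, [/\ X z, forall k, 0 <= z k &
    forall m, (m %| M)%N ->
      m%:R `^ g / (C * M%:R `^ eta) <= Nrm (sigma_up m z) <= C * M%:R `^ eta * m%:R `^ g].

Lemma powR_natD (m : nat) (s t : R) : (0 < m)%N ->
  m%:R `^ (s + t) = m%:R `^ s * m%:R `^ t.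
Proof. by move=> m0; rewrite powRD // pnatr_eq0 -lt0n m0 implybT. Qed.

Lemma powR_nat_mono (m n : nat) (s : R) : (m <= n)%N -> 0 <= s -> m%:R `^ s <= n%:R `^ s.
Proof. by move=> mn s0; rewrite ge0_ler_powR ?nnegrE ?ler0n ?ler_nat. Qed.

(** A near-maximizer for [sigma_M] works for each [m] with [M = d * m]: [b M / 2 <= Nrm (sigma_M z)
    <= b d * Nrm (sigma_m z)], and [M^beta = d^beta * m^beta]. The 2 in [2 * C] pays for reaching
    only half of the operator norm. *)
Lemma beta_almost_power : almost_power (boyd_beta X Nrm).
Proof.
move=> eta eta0; set bt := boyd_beta X Nrm.
have [lo /(_ eta eta0)[C C0 hi]] := beta_growth HX X_neq0.
exists (2 * C) => [|M M0]; first by rewrite mulr_gt0.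
have [x [Xx x1 xM]] := up_adherent HX X_neq0 M0.
pose z k := `|x k|; have Xz : X z := mem_abs Xx.
have z1 : Nrm z <= 1 by rewrite nrm_abs.
exists z; split=> // [k|m /dvdnP[d Md]]; first exact: normr_ge0.
have m0 : (0 < m)%N by move: M0; rewrite Md muln_gt0 => /andP[].
have d0 : (0 < d)%N by move: M0; rewrite Md muln_gt0 => /andP[].
have zM : Nrm (sigma_up M z) = Nrm (sigma_up M x) by apply: nrm_abs; apply: (mem_up HX).
have Xmz := mem_up HX m0 Xz.
have up1 := up_ub HX m0 Xz.
have up2 := up_ub HX d0 Xmz.
rewrite sigma_upM -Md zM in up2.
have := lo M M0; rewrite -/bt {1}Md natrM powRM ?ler0n // => loM.
have him := hi _ m0; rewrite powR_natD // -/bt in him.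
have hid := hi _ d0; rewrite powR_natD // -/bt in hid.
have Hm : m%:R `^ eta <= M%:R `^ eta.
  by apply: powR_nat_mono; [rewrite Md leq_pmull | exact: ltW].
have Hd : d%:R `^ eta <= M%:R `^ eta.
  by apply: powR_nat_mono; [rewrite Md leq_pmulr | exact: ltW].
have A0 : 0 < m%:R `^ bt by rewrite powR_gt0 ?ltr0n.
have D0 : 0 < d%:R `^ bt by rewrite powR_gt0 ?ltr0n.
have E0 : 0 < d%:R `^ eta by rewrite powR_gt0 ?ltr0n.
have F0 : 0 < m%:R `^ eta by rewrite powR_gt0 ?ltr0n.
have H0 : 0 < M%:R `^ eta by rewrite powR_gt0 ?ltr0n.
have N0 := nrm_ge0 HX Xmz.
have b0 := up_gt0 HX X_neq0 m0.
have CD0 : 0 < C * d%:R `^ bt by rewrite mulr_gt0.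
have CA0 : 0 < C * m%:R `^ bt by rewrite mulr_gt0.
apply/andP; split.
  rewrite ler_pdivrMr ?mulr_gt0 // -(ler_pM2r D0).
  have := ler_wpM2r N0 hid.
  have := ler_wpM2r N0 (ler_wpM2l (ltW CD0) Hd).
  lra.
have := ler_wpM2l (ltW CA0) Hm.
have := ler_wpM2l (ltW b0) z1.
have : 0 < C * m%:R `^ bt * M%:R `^ eta by rewrite mulr_gt0.
lra.
Qed.

(** The near-extremal vector is now the image [w = sigma_{1/M} |x|]: its norm is at least
    [M^(-alpha) / 2], while [sigma_M w] has norm at most 1. For [M = d * m], [down_lb] from [w] to
    [sigma_m w] gives the lower bound, and from [sigma_m w] to [sigma_M w] the upper one. *)
Lemma alpha_almost_power : almost_power (boyd_alpha X Nrm).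
Proof.
move=> eta eta0; set al := boyd_alpha X Nrm.
have [lo /(_ eta eta0)[C C0 hi]] := alpha_growth HX X_neq0.
exists (2 * C) => [|M M0]; first by rewrite mulr_gt0.
have [x [Xx x1 xM]] := down_adherent HX X_neq0 M0.
pose w := sigma_down M (fun k => `|x k|).
have Xw : X w := mem_down HX M (mem_abs Xx).
have MA0 : 0 < M%:R `^ al by rewrite powR_gt0 ?ltr0n.
have w0 k : 0 <= w k.
  by rewrite mulr_ge0 ?invr_ge0 ?ler0n // sumr_ge0.
have wM : Nrm (sigma_up M w) <= 1.
  by apply: le_trans (nrm_up_down HX M0 (mem_abs Xx)) _; rewrite nrm_abs.
have wlo : (M%:R `^ al)^-1 / 2 <= Nrm w.
  rewrite -powRN; apply: le_trans (_ : opnorm X Nrm (sigma_down M) / 2 <= _).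
    by rewrite ler_pM2r ?lo // invr_gt0.
  apply: le_trans xM _; apply: (nrm_le HX) => // k.
  rewrite (ger0_norm (w0 k)) normrM ger0_norm ?invr_ge0 ?ler0n //.
  by rewrite ler_wpM2l ?invr_ge0 ?ler0n // ler_norm_sum.
exists (fun k => M%:R `^ al * w k); split=> [|k|m /dvdnP[d Md]].
- exact: (memZ HX).
- by rewrite mulr_ge0 // ltW.
have m0 : (0 < m)%N by move: M0; rewrite Md muln_gt0 => /andP[].
have d0 : (0 < d)%N by move: M0; rewrite Md muln_gt0 => /andP[].
have Xmw := mem_up HX m0 Xw.
rewrite sigma_upZ (nrmZ HX) // gtr0_norm //.
have dn1 := down_lb HX m0 Xw.
have dn2 := down_lb HX d0 Xmw; rewrite sigma_upM -Md in dn2.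
have him := hi _ m0; rewrite powR_natD // -/al powRN in him.
have hid := hi _ d0; rewrite powR_natD // -/al powRN in hid.
have Hm : m%:R `^ eta <= M%:R `^ eta.
  by apply: powR_nat_mono; [rewrite Md leq_pmull | exact: ltW].
have Hd : d%:R `^ eta <= M%:R `^ eta.
  by apply: powR_nat_mono; [rewrite Md leq_pmulr | exact: ltW].
have A0 : 0 < m%:R `^ al by rewrite powR_gt0 ?ltr0n.
have D0 : 0 < d%:R `^ al by rewrite powR_gt0 ?ltr0n.
have H0 : 0 < M%:R `^ eta by rewrite powR_gt0 ?ltr0n.
have N0 := nrm_ge0 HX Xmw.
have a0 := down_gt0 HX X_neq0 d0.
have MAD : M%:R `^ al = d%:R `^ al * m%:R `^ al by rewrite Md natrM powRM ?ler0n.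
have AC0 : 0 <= C / m%:R `^ al by rewrite divr_ge0 ?ltW.
have DC0 : 0 <= C / d%:R `^ al by rewrite divr_ge0 ?ltW.
apply/andP; split.
  rewrite ler_pdivrMr ?mulr_gt0 //.
  have := ler_wpM2r N0 him.
  have := ler_wpM2r N0 (ler_wpM2l AC0 Hm).
  have : (M%:R `^ al)^-1 / 2 <= C / m%:R `^ al * M%:R `^ eta * Nrm (sigma_up m w) ->
    m%:R `^ al <= M%:R `^ al * Nrm (sigma_up m w) * (2 * C * M%:R `^ eta).
    rewrite -(ler_pM2l MA0) mulrA divff ?gt_eqF // -(ler_pM2r A0).
    rewrite (_ : _ * (C / _ * _ * _) * _ =
      M%:R `^ al * (C * M%:R `^ eta * Nrm (sigma_up m w)) * (m%:R `^ al / m%:R `^ al)).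
      by rewrite divff ?gt_eqF //; lra.
    by ring.
  by move=> H h1 h2; apply: H; lra.
have h1 := ler_wpM2l (ltW a0) wM.
have h2 := ler_wpM2l DC0 Hd.
have h3 : Nrm (sigma_up m w) <= C / d%:R `^ al * M%:R `^ eta by lra.
have := ler_wpM2l (ltW MA0) h3.
rewrite {2}MAD (_ : _ * _ * (C / _ * _) =
  (C * M%:R `^ eta * m%:R `^ al) * (d%:R `^ al / d%:R `^ al)); last by ring.
rewrite divff ?gt_eqF //.
have : 0 < C * M%:R `^ eta * m%:R `^ al by rewrite !mulr_gt0.
lra.
Qed.

End AlmostPower.

(** * Weighted sums over products of powers *)

Section Box.
Variable R : realType.
Implicit Types (F : nat -> R) (l : seq nat).

(* [box w L l F] integrates [F] over the products [prod_{j in l} j^{k_j}] with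
   [k_j < L], the exponent [k_j] carrying the weight [w k_j]. *)
Fixpoint box (w : nat -> R) (L : nat) l F : R :=
  if l is j :: l' then \sum_(k < L) w k * box w L l' (fun m => F (j ^ k * m)%N)
  else F 1%N.

Lemma eq_box w L l F G : F =1 G -> box w L l F = box w L l G.
Proof.
elim: l F G => [|j l IH] F G FG /=; first exact: FG.
by apply: eq_bigr => k _; rewrite (IH _ (fun m => G (j ^ k * m)%N)).
Qed.

Lemma box_scale w L l F c : box w L l (fun m => c * F m) = c * box w L l F.
Proof.
elim: l F => [//|j l IH] F /=.
by rewrite mulr_sumr; apply: eq_bigr => k _; rewrite (IH (fun m => F (j ^ k * m)%N)) mulrCA.
Qed.

Lemma box_ge0 w L l F : (forall k, 0 <= w k) -> (forall m, 0 <= F m) -> 0 <= box w L l F.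
Proof.
move=> w0; elim: l F => [|j l IH] F F0 //=.
by apply: sumr_ge0 => k _; rewrite mulr_ge0 // IH.
Qed.

Lemma box_le w v L L' l F : (L <= L')%N -> (forall k, 0 <= w k <= v k) ->
  (forall m, 0 <= F m) -> box w L l F <= box v L' l F.
Proof.
move=> LL wv; have w0 k : 0 <= w k by case/andP: (wv k).
have v0 k : 0 <= v k by case/andP: (wv k) => ?; apply: le_trans.
elim: l F => [|j l IH] F F0 //=.
rewrite (big_ord_widen L' (fun k => w k * box w L l (fun m => F (j ^ k * m)%N)) LL).
rewrite big_mkcond; apply: ler_sum => k _; case: ifP => _; last first.
  by rewrite mulr_ge0 // box_ge0.
apply: ler_pM => //; [exact: box_ge0 | by case/andP: (wv k) | exact: IH].
Qed.

(** The term with all exponents equal to [k0] has weight 1. It will keep the averaged vector away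
    from 0. *)
Lemma box_term w L l F k0 : (k0 < L)%N -> (forall k, 0 <= w k) -> w k0 = 1 ->
  (forall m, 0 <= F m) -> F ((\prod_(j <- l) j) ^ k0)%N <= box w L l F.
Proof.
move=> k0L w0 wk0; elim: l F => [|j l IH] F F0 /=.
  by rewrite big_nil exp1n.
rewrite (bigD1 (Ordinal k0L)) //= wk0 mul1r big_cons expnMn -[leLHS]addr0.
apply: lerD; first exact: (IH (fun m => F (j ^ k0 * m)%N)).
by apply: sumr_ge0 => k _; rewrite mulr_ge0 // box_ge0.
Qed.

(** A count of the terms. Every product that occurs divides the [L.-1]-th power of the product of
    [l], so control on divisors is all that is asked of [F]. *)
Lemma box_bound w L l F D : (forall k, 0 <= w k <= 1) ->
  (forall m, (m %| (\prod_(j <- l) j) ^ L.-1)%N -> F m <= D) -> 0 <= D ->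
  box w L l F <= L%:R ^+ size l * D.
Proof.
move=> w01; elim: l F => [|j l IH] F FD D0 /=.
  by rewrite expr0 mul1r FD // dvd1n.
rewrite exprS -mulrA -[X in X%:R * _](card_ord L) mulr_natl -sumr_const.
apply: ler_sum => k _.
have {}IH : box w L l (fun m => F (j ^ k * m)%N) <= L%:R ^+ size l * D.
  apply: IH => // m mdvd; apply: FD; rewrite big_cons expnMn dvdn_mul //.
  by apply: dvdn_exp2l; case: k => k /=; lia.
have /andP[wk0 wk1] := w01 k.
have LD : 0 <= L%:R ^+ size l * D by rewrite mulr_ge0 // exprn_ge0.
nra.
Qed.

Section Shift.
Variables (w : nat -> R) (L : nat) (d e : R).
Hypothesis w01 : forall k, 0 <= w k <= 1.
Hypothesis wS : forall k, `|w k - w k.+1| <= d * w k.+1.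
Hypothesis w_first : w 0%N <= e.
Hypothesis w_last : w L <= e.
Hypothesis d0 : 0 <= d.

(** Summation by parts: the interior terms carry [w k - w k.+1], a small fraction of [w k.+1], and
    only the two end terms remain, with weights at most [e]. *)
Lemma shift_sum (G : nat -> R) : (forall k, 0 <= G k) ->
  `|\sum_(k < L.+1) w k * G k.+1 - \sum_(k < L.+1) w k * G k| <=
  d * \sum_(k < L.+1) w k * G k + e * \sum_(k < L.+2) G k.
Proof.
move=> G0.
have w0 k : 0 <= w k by case/andP: (w01 k).
rewrite big_ord_recr /= [X in _ - X]big_ord_recl /=.
have -> : \sum_(k < L) w k * G k.+1 + w L * G L.+1 -
    (w 0%N * G 0%N + \sum_(k < L) w (bump 0 k) * G (bump 0 k)) =
    \sum_(k < L) (w k - w k.+1) * G k.+1 + (w L * G L.+1 - w 0%N * G 0%N).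
  have -> : \sum_(k < L) (w k - w k.+1) * G k.+1 =
      \sum_(k < L) w k * G k.+1 - \sum_(k < L) w (bump 0 k) * G (bump 0 k).
    by rewrite -sumrB; apply: eq_bigr => k _; rewrite mulrBl.
  by ring.
apply: le_trans (ler_normD _ _) _; apply: lerD.
  rewrite big_ord_recl /= mulrDr; apply: le_trans (ler_norm_sum _ _ _) _.
  rewrite -[leLHS]add0r; apply: lerD; first by rewrite !mulr_ge0.
  rewrite mulr_sumr; apply: ler_sum => k _.
  by rewrite normrM (ger0_norm (G0 _)) mulrA ler_wpM2r.
rewrite big_ord_recl big_ord_recr /=.
have S0 : 0 <= \sum_(k < L) G (bump 0 k) by apply: sumr_ge0.
have := w0 0%N; have := w0 L; have := G0 0%N; have := G0 L.+1.
have e0 : 0 <= e by apply: le_trans w_first.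
move: w_first w_last; rewrite /bump /= add1n => wf wl GL G0' wL w00.
apply: le_trans (ler_normB _ _) _; rewrite !ger0_norm ?mulr_ge0 //.
have := ler_wpM2r GL wl; have := ler_wpM2r G0' wf; have := mulr_ge0 e0 S0.
lra.
Qed.

(** Multiplication by [j] raises the exponent of one factor [j] and leaves the others alone, so
    [shift_sum] is applied in that coordinate only. The boundary error reaches exponent [L.+1],
    hence the unweighted box of side [L.+2]. *)
Lemma box_shift l F j : j \in l -> (forall m, 0 <= F m) ->
  `|box w L.+1 l (fun m => F (j * m)%N) - box w L.+1 l F| <=
  d * box w L.+1 l F + e * box (fun=> 1) L.+2 l F.
Proof.
have e0 : 0 <= e by case/andP: (w01 0%N) => ? _; apply: le_trans w_first.
have w0 k : 0 <= w k by case/andP: (w01 k).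
elim: l F => [//|i l IH] F; rewrite inE => jl F0 /=.
pose G k := box w L.+1 l (fun m => F (i ^ k * m)%N).
pose G1 k := box (fun=> 1) L.+2 l (fun m => F (i ^ k * m)%N).
have G0 k : 0 <= G k by apply: box_ge0.
have GG1 k : G k <= G1 k by apply: box_le => // k'; rewrite w0 /=; case/andP: (w01 k').
have [/eqP ji|] := boolP (j == i).
  rewrite ji (eq_bigr (fun k : 'I_L.+1 => w k * G k.+1)) => [|k _]; last first.
    by congr (_ * _); apply: eq_box => m; rewrite expnS mulnA.
  apply: le_trans (shift_sum G0) _; rewrite lerD2l ler_wpM2l //.
  by apply: ler_sum => k _; rewrite mul1r.
move=> ji; have {}jl : j \in l by move: jl; rewrite (negbTE ji).
have key k : `|w k * box w L.+1 l (fun m => F (j * (i ^ k * m))%N) - w k * G k| <=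
    d * (w k * G k) + e * G1 k.
  rewrite -mulrBr normrM (ger0_norm (w0 k)).
  rewrite (_ : box _ _ _ _ = box w L.+1 l (fun m => F (i ^ k * (j * m))%N)); last first.
    by apply: eq_box => m; rewrite mulnCA.
  have := ler_wpM2l (w0 k) (IH (fun m => F (i ^ k * m)%N) jl (fun m => F0 _)).
  have : 0 <= e * G1 k by rewrite mulr_ge0 // (le_trans (G0 k)).
  by case/andP: (w01 k); rewrite -/(G k) -/(G1 k); nra.
rewrite -sumrB; apply: le_trans (ler_norm_sum _ _ _) _.
apply: le_trans (ler_sum _ (fun (k : 'I_L.+1) _ => key k)) _.
rewrite big_split /= -!mulr_sumr lerD2l ler_wpM2l //.
by rewrite mul1r [leRHS]big_ord_recr /= lerDl (le_trans (G0 _) (GG1 _)).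
Qed.

End Shift.
End Box.

(** * A two-sided geometric weight *)

Section TentWeight.
Variables (R : realType) (kappa : R) (k0 : nat).
Hypothesis kappa0 : 0 <= kappa.

Definition tent (k : nat) : R := expR (- kappa * `|k%:R - k0%:R|).

Lemma tent01 k : 0 <= tent k <= 1.
Proof.
rewrite expR_ge0 /= /tent -expR0 ler_expR mulNr oppr_le0 mulr_ge0 //.
Qed.

Lemma tent_top : tent k0 = 1.
Proof. by rewrite /tent subrr normr0 mulr0 expR0. Qed.

Lemma tent_first : tent 0 = expR (- kappa * k0%:R).
Proof. by rewrite /tent sub0r normrN ger0_norm. Qed.

Lemma tent_last : tent (2 * k0) = expR (- kappa * k0%:R).
Proof.
rewrite /tent natrM (_ : _ - _ = k0%:R); last by ring.
by rewrite ger0_norm.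
Qed.

(** Neighbouring values differ by a factor at most [expR kappa] in either direction. The bound is
    relative to the right neighbour because summation by parts pairs [w k.+1] with [G k.+1]. *)
Lemma tentS k : `|tent k - tent k.+1| <= (expR kappa - 1) * tent k.+1.
Proof.
set A := `|k%:R - k0%:R| : R; set B := `|k.+1%:R - k0%:R| : R.
have AB : `|A - B| <= 1.
  apply: le_trans (ler_dist_dist _ _) _.
  by rewrite -natr1 (_ : _ - _ = -1) ?normrN1 //; ring.
move: AB; rewrite ler_norml => /andP[AB1 AB2].
have up : tent k <= expR kappa * tent k.+1.
  have : 0 <= kappa * (1 + (A - B)) by rewrite mulr_ge0 //; lra.
  by rewrite /tent -/A -/B -expRD ler_expR; lra.
have lo : tent k.+1 <= expR kappa * tent k.
  have : 0 <= kappa * (1 - (A - B)) by rewrite mulr_ge0 //; lra.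
  by rewrite /tent -/A -/B -expRD ler_expR; lra.
have E1 : 1 <= expR kappa by rewrite -expR0 ler_expR.
have := expR_ge0 (- kappa * A); have := expR_ge0 (- kappa * B).
rewrite -/(tent k) -/(tent k.+1) ler_norml.
move=> t1 t2; apply/andP; split; last lra.
case: (lerP (tent k.+1) (tent k)) => ?; nra.
Qed.

End TentWeight.

(** Budget in the exponent: [- kappa k0] from the boundary weight, [kappa k0 / 2] from the last
    factor, and [kappa k0 / 4] granted to the polynomial. What is left is [- kappa k0 / 4], up to
    the constants collected in [B]. *)
Lemma expR_beats_poly (R : realType) (kappa C d : R) (J : nat) :
  0 < kappa -> 0 < C -> 0 < d ->
  exists k0 : nat, C * expR (- kappa * k0%:R) * (2 * k0).+2%:R ^+ J *
    expR ((2 * k0).+1%:R * (kappa / 4)) <= d.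
Proof.
move=> k_gt0 C0 d0.
(* The polynomial is bounded by [th * N <= expR (th * N)] raised to the power [J], so
   [th * J <= kappa / 8] is wanted; [J.+1] covers [J = 0]. *)
pose th := kappa / (8 * J.+1%:R).
have th0 : 0 < th by rewrite divr_gt0 // mulr_gt0.
have thJ : th * J%:R <= kappa / 8.
  rewrite /th invfM mulrA -mulrA ler_piMr ?divr_ge0 ?(ltW k_gt0) //.
  by rewrite mulrC ler_pdivrMr ?ltr0n // mul1r ler_nat.
pose B := C / d * (th ^+ J)^-1 * expR (kappa / 2).
have B0 : 0 < B.
  by rewrite mulr_gt0 ?expR_gt0 // mulr_gt0 ?divr_gt0 // invr_gt0 exprn_gt0.
pose k0 := (Num.truncn (4 / kappa * B)).+1; exists k0.
have k0B : B <= expR (kappa / 4 * k0%:R).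
  have := Num.Theory.truncnS_gt (4 / kappa * B); rewrite -/k0 => kB.
  apply: le_trans _ (expR_ge1Dx _).
  have : B <= kappa / 4 * k0%:R.
    rewrite -ler_pdivrMl ?divr_gt0 //; rewrite invf_div; exact: ltW.
  lra.
have poly : (2 * k0).+2%:R ^+ J <= (th ^+ J)^-1 * expR ((2 * k0).+2%:R * (kappa / 8)).
  rewrite ler_pdivlMl ?exprn_gt0 // -exprMn.
  apply: le_trans (_ : expR (th * (2 * k0).+2%:R) ^+ J <= _).
    apply: lerXn2r; rewrite ?nnegrE ?expR_ge0 ?(mulr_ge0 (ltW th0)) //.
    by apply: le_trans _ (expR_ge1Dx _); rewrite lerDr.
  by rewrite -expRM_natl ler_expR; have := ler_wpM2l (ler0n R (2 * k0).+2) thJ; lra.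
rewrite -[leRHS]mulr1 -ler_pdivrMl //.
set k := k0%:R : R in k0B *.
have e2 : (2 * k0).+2%:R = 2 * k + 2 :> R by rewrite -addn2 natrD natrM.
have e1 : (2 * k0).+1%:R = 2 * k + 1 :> R by rewrite -addn1 natrD natrM.
apply: le_trans (_ : B * expR (- (kappa / 4 * k)) <= _); last first.
  by rewrite expRN ler_pdivrMr ?expR_gt0 // mul1r.
apply: le_trans (_ : d^-1 * (C * expR (- kappa * k) *
   ((th ^+ J)^-1 * expR ((2 * k0).+2%:R * (kappa / 8))) *
    expR ((2 * k0).+1%:R * (kappa / 4))) <= _).
  rewrite ler_pM2l ?invr_gt0 // ler_pM2r ?expR_gt0 // ler_pM2l //.
  by rewrite mulr_gt0 ?expR_gt0.
rewrite /B e1 e2.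
have -> : d^-1 * (C * expR (- kappa * k) *
   ((th ^+ J)^-1 * expR ((2 * k + 2) * (kappa / 8))) *
    expR ((2 * k + 1) * (kappa / 4))) =
  C / d / th ^+ J * (expR (- kappa * k) * expR ((2 * k + 2) * (kappa / 8)) *
     expR ((2 * k + 1) * (kappa / 4))) by ring.
rewrite -[leRHS]mulrA -!expRD ler_pM2l ?ler_expR; first by lra.
by rewrite divr_gt0 ?exprn_gt0 // divr_gt0.
Qed.

(** * Approximate common eigenvectors of the dilations *)

Section ApproximateEigenvector.
Variables (R : realType) (X : set (nat -> R)) (Nrm : (nat -> R) -> R).
Hypothesis HX : symmetric_seq_space X Nrm.

(** The factors in [l] are kept positive because in the application [u m] is a multiple of
    [sigma_up m z], and [sigma_up 0 z] is a constant sequence, possibly outside [X]. *)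
Lemma box_nrm (w : nat -> R) L l (u : nat -> nat -> R) :
  (forall k, 0 <= w k) -> all (leq 1) l -> (forall m, (0 < m)%N -> X (u m)) ->
  X (fun n => box w L l (fun m => u m n)) /\
  Nrm (fun n => box w L l (fun m => u m n)) <= box w L l (fun m => Nrm (u m)).
Proof.
move=> w0; elim: l u => [|j l IH] u /= => [_ Xu|/andP[j0 l0] Xu].
  by split; [exact: Xu | exact: lexx].
have {}IH k : X (fun n => box w L l (fun m => u (j ^ k * m)%N n)) /\
    Nrm (fun n => box w L l (fun m => u (j ^ k * m)%N n)) <=
    box w L l (fun m => Nrm (u (j ^ k * m)%N)).
  by apply: (IH (fun m => u (j ^ k * m)%N)) => // m m0; apply: Xu; rewrite muln_gt0 expn_gt0 j0 m0.
have XF (k : 'I_L) : X (fun n => w k * box w L l (fun m => u (j ^ k * m)%N n)).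
  by apply: (memZ HX); case: (IH k).
split; first exact: (mem_sum HX).
apply: le_trans (nrm_sum HX _ XF) _; apply: ler_sum => k _.
have [Xk Nk] := IH k.
by rewrite (nrmZ HX) // ger0_norm // ler_wpM2l.
Qed.

Lemma approximate_eigenvector (g : R) : almost_power X Nrm g ->
  forall (J : nat) (delta : R), 0 < delta ->
  exists x, [/\ X x, Nrm x = 1 & forall j, (0 < j <= J)%N ->
    Nrm (fun k => sigma_up j x k - j%:R `^ g * x k) <= delta * j%:R `^ g].
Proof.
move=> apg J delta delta0.
(* Half of [delta] goes to the change of weights, [expR kappa - 1], and half to the boundary
   terms. *)
pose kappa := ln (1 + delta / 2).
have kappa_gt0 : 0 < kappa by rewrite ln_gt0 //; lra.
have exp_kappa : expR kappa - 1 = delta / 2.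
  by rewrite lnK ?posrE; lra.
pose l := iota 1 J; pose P := (\prod_(j <- l) j)%N.
have l1 : all (leq 1) l by apply/allP => j; rewrite mem_iota => /andP[].
have P0 : (0 < P)%N.
  rewrite /P; elim: (l) l1 => [|j l' IH] /=; first by rewrite big_nil.
  by rewrite big_cons muln_gt0 => /andP[-> /IH].
(* Chosen so that [P^(2 eta) <= expR (kappa / 4)]; the summand 1 covers [P = 1]. *)
pose eta := kappa / (8 * (1 + ln P%:R)).
have lnP := ln_nat_ge0 R P.
have eta_gt0 : 0 < eta by rewrite divr_gt0 // mulr_gt0 //; lra.
have eta_lnP : 2 * eta * ln P%:R <= kappa / 4.
  have -> : 2 * eta * ln P%:R = kappa / 4 * (ln P%:R / (1 + ln P%:R)).
    by rewrite /eta; field; rewrite gt_eqF //; lra.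
  by rewrite ler_piMr ?(divr_ge0 (ltW kappa_gt0)) // ler_pdivrMr ?mul1r; lra.
have [C C0 hC] := apg _ eta_gt0.
have [k0 hk0] := @expR_beats_poly R kappa (C * C) (delta / 2) J kappa_gt0
  (mulr_gt0 C0 C0) (divr_gt0 delta0 (ltr0Sn _ _)).
(* The average uses exponents up to [2 * k0], but the error box of side [(2 * k0).+2] goes one
   further. *)
pose M := (P ^ (2 * k0).+1)%N.
have M0 : (0 < M)%N by rewrite expn_gt0 P0.
have [z [Xz z0 hz]] := hC _ M0.
pose H := M%:R `^ eta.
have H0 : 0 < H by rewrite powR_gt0 ?ltr0n.
have HH : H * H <= expR ((2 * k0).+1%:R * (kappa / 4)).
  rewrite /H /powR gt_eqF ?ltr0n // -expRD ler_expR ln_natX //.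
  by have := ler_wpM2l (ler0n R (2 * k0).+1) eta_lnP; lra.
pose u m n := m%:R `^ (- g) * sigma_up m z n.
have Xu m : (0 < m)%N -> X (u m) by move=> m0; apply/(memZ HX)/(mem_up HX).
have u0 m n : 0 <= u m n by rewrite mulr_ge0 ?powR_ge0 //; exact: z0.
have uN m : (m %| M)%N -> (C * H)^-1 <= Nrm (u m) <= C * H.
  move=> mM; have m0 : (0 < m)%N by apply: dvdn_gt0 mM.
  have mg0 : 0 < m%:R `^ g by rewrite powR_gt0 ?ltr0n.
  have /andP[lo hi] := hz m mM; rewrite -/H in lo hi.
  rewrite (nrmZ HX) ?ger0_norm ?powR_ge0 //; last exact: (mem_up HX).
  by rewrite powRN ler_pdivlMl // ler_pdivrMl // lo /= mulrC.
have w01 := tent01 k0 (ltW kappa_gt0).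
have w0 k : 0 <= tent kappa k0 k by case/andP: (w01 k).
pose y n := box (tent kappa k0) (2 * k0).+1 l (fun m => u m n).
pose err n := box (fun=> 1) (2 * k0).+2 l (fun m => u m n).
have [Xy _] : X y /\ _ := box_nrm (2 * k0).+1 w0 l1 Xu.
have one0 (k : nat) : 0 <= 1 :> R by [].
have [Xerr Nerr] : X err /\ _ := box_nrm (2 * k0).+2 one0 l1 Xu.
have y0 n : 0 <= y n by apply: box_ge0.
have err0 n : 0 <= err n by apply: box_ge0.
(* By positivity [y] dominates its single term at [P ^ k0]. *)
have Ny : (C * H)^-1 <= Nrm y.
  have Pk : (P ^ k0 %| M)%N by rewrite dvdn_exp2l // leqW // leq_pmull.
  case/andP: (uN _ Pk) => + _ => /le_trans; apply.
  apply: (nrm_le HX) => // n; rewrite !ger0_norm //.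
  by apply: box_term => //; [rewrite ltnS leq_pmull | exact: tent_top].
have CH0 : 0 < C * H by rewrite mulr_gt0.
have Ny0 : 0 < Nrm y by apply: lt_le_trans Ny; rewrite invr_gt0.
pose e := expR (- kappa * k0%:R).
have Nerr' : e * Nrm err <= delta / 2 * Nrm y.
  apply: le_trans (_ : delta / 2 * (C * H)^-1 <= _); last first.
    by rewrite ler_wpM2l // divr_ge0 // ltW.
  rewrite ler_pdivlMr //.
  have : Nrm err <= (2 * k0).+2%:R ^+ J * (C * H).
    apply: le_trans Nerr _; rewrite -(size_iota 1 J) -/l.
    apply: box_bound => [k|m mM|]; last exact: ltW.
      by rewrite ler01 lexx.
    by case/andP: (uN _ mM).
  move=> /(ler_wpM2l (expR_ge0 (- kappa * k0%:R))) /(ler_wpM2r (ltW CH0)).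
  rewrite -/e => /le_trans; apply; apply: le_trans hk0.
  rewrite -/e (_ : e * _ * _ = C * C * e * (2 * k0).+2%:R ^+ J * (H * H)); last by ring.
  by rewrite ler_wpM2l // mulr_ge0 ?exprn_ge0 // mulr_ge0 ?expR_ge0 // mulr_ge0 ?ltW.
have key j : (0 < j <= J)%N ->
    Nrm (fun n => sigma_up j y n - j%:R `^ g * y n) <= delta * j%:R `^ g * Nrm y.
  move=> jJ; have j0 : (0 < j)%N by case/andP: jJ.
  have jg0 : 0 < j%:R `^ g by rewrite powR_gt0 ?ltr0n.
  have jl : j \in l by rewrite /l mem_iota add1n ltnS.
  have shift n : `|box (tent kappa k0) (2 * k0).+1 l (fun m => u (j * m)%N n) - y n| <=
      (delta / 2) * y n + e * err n.
    rewrite -exp_kappa; apply: (@box_shift R (tent kappa k0) (2 * k0)) => //.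
    - exact/tentS/ltW.
    - by rewrite tent_first.
    - by rewrite tent_last.
    - by rewrite exp_kappa divr_ge0 // ltW.
  (* With the normalization of [u], [sigma_j] maps [u m] to [j^g] times [u (j * m)], so applying it
     to [y] is a shift of the box. *)
  have Esig n : sigma_up j y n =
      j%:R `^ g * box (tent kappa k0) (2 * k0).+1 l (fun m => u (j * m)%N n).
    rewrite -box_scale; apply: eq_box => m; rewrite /u natrM powRM ?ler0n // -mulrA (powRN j%:R).
    by rewrite mulVKf ?gt_eqF // -sigma_upM.
  pose bd n := j%:R `^ g * (delta / 2 * y n + e * err n).
  have Xbd : X bd by apply/(memZ HX)/(memD HX); exact: (memZ HX).
  apply: le_trans (_ : Nrm bd <= _).
    apply: (nrm_le HX) => // n; rewrite Esig -mulrBr normrM gtr0_norm //.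
    rewrite (ger0_norm (_ : 0 <= bd n)).
      by rewrite ler_wpM2l // ltW.
    by rewrite mulr_ge0 ?(ltW jg0) // addr_ge0 ?mulr_ge0 ?expR_ge0 // ltW.
  rewrite (nrmZ HX); last by apply: (memD HX); exact: (memZ HX).
  rewrite gtr0_norm // (mulrC delta (_ `^ _)) -[leRHS]mulrA ler_pM2l //.
  apply: le_trans (nrmD HX _ _) _; try exact: (memZ HX).
  rewrite !(nrmZ HX) // !ger0_norm ?expR_ge0 ?divr_ge0 ?(ltW delta0) //.
  by apply: le_trans (lerD (lexx _) Nerr') _; rewrite -mulrDl -splitr.
exists (fun n => (Nrm y)^-1 * y n); split.
- exact: (memZ HX).
- by rewrite (nrmZ HX) // ger0_norm ?invr_ge0 ?(ltW Ny0) // mulVf ?gt_eqF.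
move=> j jJ; have j0 : (0 < j)%N by case/andP: jJ.
rewrite (_ : (fun k => _) = fun n => (Nrm y)^-1 * (sigma_up j y n - j%:R `^ g * y n)).
  rewrite (nrmZ HX); last by apply: (memB HX); [exact: (mem_up HX) | exact: (memZ HX)].
  by rewrite ger0_norm ?invr_ge0 ?(ltW Ny0) // ler_pdivrMl // mulrC key.
by apply/funext => n; rewrite sigma_upZ mulrBr; congr (_ - _); rewrite mulrCA.
Qed.

End ApproximateEigenvector.

(** * Numbering a disjoint union of blocks of sizes [m i] *)

Section MultiplicityBijection.
Variables (n : nat) (m : nat -> nat).

Let T := {i : 'I_n & 'I_(m i)}.
Let M := (\sum_(i < n) m i)%N.

Lemma card_blocks : #|{: T}| = M.
Proof.
rewrite card_tagged sumnE big_map big_enum /=.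
by apply: eq_bigr => i _; rewrite card_ord.
Qed.

Definition block_rank (t : T) : 'I_M := cast_ord card_blocks (enum_rank t).
Definition block_of (r : 'I_M) : T := enum_val (cast_ord (esym card_blocks) r).

Lemma block_rank_inj : injective block_rank.
Proof. by move=> s t /cast_ord_inj /enum_rank_inj. Qed.

Lemma block_of_inj : injective block_of.
Proof. by move=> s t /enum_val_inj /cast_ord_inj. Qed.

(** The positions are compared as natural numbers, since their ordinal types depend on the tags. *)
Lemma block_eq (s t : T) : tag s = tag t :> nat -> tagged s = tagged t :> nat -> s = t.
Proof.
case: s t => [i r] [j s] /= /val_inj ij; move: s; rewrite -ij => s rs.
by congr existT; apply: val_inj.
Qed.

End MultiplicityBijection.

(** * Combinations of disjoint copies of an approximate eigenvector *)

Section LpRepresentation.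
Variables (R : realType) (X : set (nat -> R)) (Nrm : (nat -> R) -> R).
Hypothesis HX : symmetric_seq_space X Nrm.
Implicit Types x y z : nat -> R.

(** Both sequences repeat each entry of [x] exactly [m 0 + ... + m n.-1] times; two dominations
    avoid building a single permutation. *)
Lemma nrm_spread_up n (m : nat -> nat) x : (0 < n)%N ->
  (forall i, (i < n)%N -> (0 < m i)%N) -> X x ->
  Nrm (spread n (fun i => sigma_up (m i) x)) = Nrm (sigma_up (\sum_(i < n) m i) x).
Proof.
move=> n0 m0 Xx; set M := (\sum_(i < n) m i)%N.
have M0 : (0 < M)%N.
  by rewrite /M (bigD1 (Ordinal n0)) //= addn_gt0 m0.
have Xs : X (spread n (fun i => sigma_up (m i) x)).
  by apply: (mem_spread HX) => // i /m0 mi; apply: (mem_up HX).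
apply/eqP; rewrite eq_le; apply/andP; split.
  apply: (nrm_dom HX); first exact: (mem_up HX).
  have lt1 k : (k %% n < n)%N by rewrite ltn_mod.
  have lt2 k : ((k %/ n) %% m (k %% n) < m (k %% n))%N by rewrite ltn_mod m0.
  pose t k : {i : 'I_n & 'I_(m i)} := Tagged (fun i : 'I_n => 'I_(m i))
    (Ordinal (lt2 k) : 'I_(m (Ordinal (lt1 k)))).
  (* An index on the left consists of a slot, an entry of [x] and a repetition number. The entry
     picks the block of length [M], and the pair of slot and repetition the place in it. *)
  exists (fun k => (k %/ n %/ m (k %% n)) * M + block_rank (t k))%N; split=> [k l _ _ kl|k _].
    have := congr1 (fun i => i %% M)%N kl; rewrite !modnMD_small //.
    move=> /val_inj /block_rank_inj tkl.
    have := congr1 (fun i => i %/ M)%N kl; rewrite !divnMD_small // => d.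
    have i_eq := congr1 (fun s : {i : 'I_n & 'I_(m i)} => tag s : nat) tkl.
    have r_eq := congr1 (fun s : {i : 'I_n & 'I_(m i)} => tagged s : nat) tkl.
    rewrite /= in i_eq r_eq; apply: (divmod_inj i_eq).
    by rewrite i_eq in r_eq d; exact: divmod_inj r_eq d.
  by rewrite /spread /sigma_up divnMD_small.
apply: (nrm_dom HX) => //.
pose t k : {i : 'I_n & 'I_(m i)} := block_of (Ordinal (ltn_pmod k M0)).
exists (fun k => ((k %/ M) * m (tag (t k)) + tagged (t k)) * n + tag (t k))%N.
split=> [k l _ _ kl|k _].
  have := congr1 (fun i => i %% n)%N kl; rewrite !modnMD_small // => i_eq.
  have := congr1 (fun i => i %/ n)%N kl; rewrite !divnMD_small // => r_eq.
  have t_eq : t k = t l.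
    apply: block_eq => //.
    have := congr1 (fun i => i %% m (tag (t k)))%N r_eq.
    by rewrite modnMD_small // [in RHS]i_eq modnMD_small.
  apply: (@divmod_inj M); first by move/block_of_inj: t_eq => [].
  have := congr1 (fun i => i %/ m (tag (t k)))%N r_eq.
  by rewrite divnMD_small // [in RHS]i_eq divnMD_small.
rewrite /spread /sigma_up modnMD_small // divnMD_small //.
by rewrite divnMD_small.
Qed.

(** After division by [s + t] both ratios lie in [[0, 1]], where [r <= r^g], and they add up to
    1. *)
Lemma powR_subadd (g s t : R) : g <= 1 -> 0 <= s -> 0 <= t ->
  (s + t) `^ g <= s `^ g + t `^ g.
Proof.
move=> g1 s0 t0.
have : 0 <= s + t by rewrite addr_ge0.
rewrite le_eqVlt => /orP[/eqP st0|st0].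
  have [-> ->] : s = 0 /\ t = 0 by split; lra.
  by rewrite addr0 lerDl powR_ge0.
have ratio_le r : 0 <= r <= s + t -> r / (s + t) <= (r / (s + t)) `^ g.
  move=> /andP[r0 rst]; have [->|rn0] := eqVneq r 0; first by rewrite mul0r powR_ge0.
  have r_gt0 : 0 < r by rewrite lt_neqAle eq_sym rn0.
  by apply: ger1_powR; rewrite ?divr_gt0 //= ler_pdivrMr // mul1r.
have factor r : 0 <= r -> r `^ g = (s + t) `^ g * (r / (s + t)) `^ g.
  move=> r0; rewrite -powRM ?divr_ge0 ?(ltW st0) //.
  by rewrite mulrCA divff ?gt_eqF // mulr1.
rewrite (factor s) // (factor t) // -mulrDr ler_peMr ?powR_ge0 //.
apply: le_trans (lerD (ratio_le s _) (ratio_le t _)); try by apply/andP; split; lra.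
by rewrite -mulrDl divff ?gt_eqF.
Qed.

(** Each [t i ^ g * x] is replaced by [Q^(-g) * sigma_{m_i} x] at cost [Q^(-g) + 2 * delta]. The
    disjoint sum becomes [Q^(-g) * sigma_M x] up to rearrangement, and a last use of the eigenvector
    property, together with [M] being close to [Q], accounts for the other errors. *)
Lemma lp_estimate (g delta : R) (n Q : nat) (t : nat -> R) x :
  0 <= g <= 1 -> 0 <= delta -> (0 < n)%N -> (0 < Q)%N ->
  (forall i, (i < n)%N -> 0 <= t i <= 1) -> \sum_(i < n) t i = 1 ->
  X x -> Nrm x = 1 ->
  (forall j, (0 < j <= Q + n)%N ->
     Nrm (fun k => sigma_up j x k - j%:R `^ g * x k) <= delta * j%:R `^ g) ->
  `|Nrm (spread n (fun i k => t i `^ g * x k)) - 1| <=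
    2 * n%:R * (Q%:R^-1 `^ g) + (3 * n%:R + 1) * delta.
Proof.
move=> /andP[g0 g1] delta0 n0 Q0 t01 tsum Xx x1 eig.
pose c := Q%:R^-1 `^ g : R.
have one_g : 1 `^ g = 1 :> R by rewrite powR1.
have Qp : 0 < Q%:R :> R by rewrite ltr0n.
have c0 : 0 <= c by rewrite powR_ge0.
have c1 : c <= 1.
  rewrite /c -[leRHS]one_g ge0_ler_powR ?nnegrE ?invr_ge0 ?ler0n // invf_le1 //.
  by rewrite ler1n.
(* Rounding up strictly keeps [m i] positive even when [t i = 0]; the sum then exceeds [Q] by at
   most [n], which explains the range [j <= Q + n]. *)
pose m i := (Num.truncn (t i * Q%:R)).+1.
have mle i : (i < n)%N -> t i <= (m i)%:R / Q%:R <= t i + Q%:R^-1.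
  move=> /t01 /andP[t0 _]; rewrite ler_pdivlMr // ler_pdivrMr // mulrDl mulVf ?gt_eqF //.
  have /andP[lo hi] := Num.Theory.truncn_itv (mulr_ge0 t0 (ltW Qp)).
  by rewrite ltW //= /m -natr1 lerD2r.
pose M := (\sum_(i < n) m i)%N.
have MQ : 1 <= (M%:R / Q%:R : R) <= 1 + n%:R / Q%:R.
  have -> : M%:R = \sum_(i < n) (m i)%:R :> R by rewrite natr_sum.
  rewrite mulr_suml; apply/andP; split.
    rewrite -[leLHS]tsum.
    by apply: ler_sum => i _; case/andP: (mle i (ltn_ord i)).
  apply: le_trans (_ : \sum_(i < n) (t i + Q%:R^-1) <= _).
    by apply: ler_sum => i _; case/andP: (mle i (ltn_ord i)).
  by rewrite big_split /= tsum sumr_const card_ord mulr_natl.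
have cM_ge1 : 1 <= c * M%:R `^ g.
  rewrite -powRM ?invr_ge0 ?ler0n // mulrC -[leLHS]one_g.
  by rewrite ge0_ler_powR ?nnegrE ?divr_ge0 //; case/andP: MQ.
have cM_le : c * M%:R `^ g <= 1 + n%:R * c.
  rewrite -powRM ?invr_ge0 ?ler0n // mulrC.
  apply: le_trans (_ : (1 + n%:R / Q%:R) `^ g <= _).
    rewrite ge0_ler_powR ?nnegrE ?addr_ge0 ?divr_ge0 //.
    by case/andP: MQ.
  apply: le_trans (powR_subadd g1 _ _) _; rewrite ?divr_ge0 //.
  rewrite powR1 lerD2l powRM ?invr_ge0 ?ler0n // ler_wpM2r //.
  by rewrite -[leRHS]powRr1 // ler_powR // ler1n.
have mQ i : (i < n)%N -> (0 < m i <= Q + n)%N.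
  move=> ilt; rewrite /m /=; have /andP[_ t1] := t01 i ilt.
  apply: leq_trans (_ : Q + 1 <= _)%N; last by rewrite leq_add2l.
  rewrite addn1 ltnS -(ler_nat R).
  have /andP[t0 _] := t01 i ilt.
  have /andP[lo _] := Num.Theory.truncn_itv (mulr_ge0 t0 (ltW Qp)).
  by apply: le_trans lo _; rewrite ler_piMl.
have M0 : (0 < M <= Q + n)%N.
  apply/andP; split; first by rewrite /M (bigD1 (Ordinal n0)).
  rewrite -(ler_nat R) natrD; case/andP: MQ => _.
  by rewrite ler_pdivrMr // mulrDl mul1r divfK ?gt_eqF.
have piece i : (i < n)%N ->
    Nrm (fun k => t i `^ g * x k - c * sigma_up (m i) x k) <= c + 2 * delta.
  move=> ilt; have /andP[lo hi] := mle i ilt; have /andP[t0 t1] := t01 i ilt.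
  have mi := mQ i ilt; have mi0 : (0 < m i)%N by [].
  pose A := c * (m i)%:R `^ g.
  have AE : A = ((m i)%:R / Q%:R) `^ g by rewrite /A -powRM ?invr_ge0 // mulrC.
  have A_lo : t i `^ g <= A.
    by rewrite AE ge0_ler_powR ?nnegrE // divr_ge0.
  have A_hi : A <= t i `^ g + c.
    rewrite AE; apply: le_trans (powR_subadd g1 t0 _); last by rewrite invr_ge0.
    by rewrite ge0_ler_powR ?nnegrE ?divr_ge0 ?addr_ge0 ?invr_ge0.
  have t_le1 : t i `^ g <= 1.
    by rewrite -[leRHS]one_g ge0_ler_powR ?nnegrE.
  have Xd : X (fun k => (m i)%:R `^ g * x k - sigma_up (m i) x k).
    by apply: (memB HX); [exact: (memZ HX) | exact: (mem_up HX)].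
  (* The first summand is the rounding error, at most [c]; the second is the eigenvector error, at
     most [A * delta] with [A <= 2]. *)
  rewrite (_ : (fun k => _) = fun k => (t i `^ g - A) * x k +
      c * ((m i)%:R `^ g * x k - sigma_up (m i) x k)); last first.
    by apply/funext => k; rewrite /A; ring.
  apply: le_trans (nrmD HX _ _) _; try exact: (memZ HX).
  rewrite !(nrmZ HX) // x1 mulr1 (ger0_norm c0) distrC ger0_norm ?subr_ge0 //.
  have := eig (m i) mi.
  rewrite (nrmBC HX) ?[in X in X -> _]/=; [|exact: (mem_up HX)|exact: (memZ HX)].
  move=> /(ler_wpM2l c0) h.
  have : A * delta <= 2 * delta by rewrite ler_wpM2r //; lra.
  by rewrite /A in A_hi *; lra.
have Xt i : (i < n)%N -> X (fun k => t i `^ g * x k) by move=> _; exact: (memZ HX).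
have Xc i : (i < n)%N -> X (fun k => c * sigma_up (m i) x k).
  by move=> _; apply/(memZ HX)/(mem_up HX).
have dist := nrm_spread_dist HX n0 Xt Xc.
have cNE : Nrm (spread n (fun i k => c * sigma_up (m i) x k)) = c * Nrm (sigma_up M x).
  rewrite -(nrm_spread_up (m := m)) // -[in RHS](ger0_norm c0) -(nrmZ HX) //.
  by apply: (mem_spread HX) => // i ilt; exact: (mem_up HX).
have sum_le : \sum_(i < n) Nrm (fun k => t i `^ g * x k - c * sigma_up (m i) x k) <=
    n%:R * (c + 2 * delta).
  rewrite -[X in X%:R * _](card_ord n) mulr_natl -sumr_const.
  by apply: ler_sum => i _; exact: piece.
have MX : X (sigma_up M x) by apply: (mem_up HX) => //; case/andP: M0.
have Mx : `|c * Nrm (sigma_up M x) - c * M%:R `^ g| <= (1 + n%:R * c) * delta.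
  rewrite -mulrBr normrM (ger0_norm c0).
  have := nrm_dist HX MX (memZ HX (M%:R `^ g) Xx).
  rewrite (nrmZ HX) // x1 mulr1 (ger0_norm (powR_ge0 _ _)) => h.
  have := ler_wpM2l c0 (le_trans h (eig M M0)).
  have := ler_wpM2r delta0 cM_le.
  lra.
rewrite cNE in dist.
have nc : n%:R * c * delta <= n%:R * delta.
  by rewrite ler_wpM2r // ler_piMr.
move: (le_trans dist sum_le) Mx; rewrite !ler_norml => /andP[d1 d2] /andP[d3 d4].
apply/andP; split; rewrite -/c; lra.
Qed.

End LpRepresentation.

(** * Finite representability and its consequences for the dilations *)

Section Representability.
Variables (R : realType) (X : set (nat -> R)) (Nrm : (nat -> R) -> R).
Hypothesis HX : symmetric_seq_space X Nrm.
Implicit Types x y z : nat -> R.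

Definition slot (n i : nat) x : nat -> R := spread n (fun j k => if j == i then x k else 0).

Lemma slot_disjoint n i j x k : i != j -> slot n i x k = 0 \/ slot n j x k = 0.
Proof.
move=> ij; rewrite /slot /spread.
have [ki|_] := eqVneq (k %% n)%N i; last by left.
by right; rewrite ki (negbTE ij).
Qed.

(** The permutation exchanges the residues [i] and [j] modulo [n]. *)
Lemma slot_same_distribution n i j x : (i < n)%N -> (j < n)%N ->
  same_ordered_distribution (slot n i x) (slot n j x).
Proof.
move=> ilt jlt.
have n0 : (0 < n)%N by lia.
pose s r := if r == i then j else if r == j then i else r.
have slt k : (s (k %% n) < n)%N.
  by rewrite /s; do 2!case: ifP => // _; rewrite ltn_mod.
have sK r : s (s r) = r.
  rewrite /s; case: (eqVneq r i) => [->|ri].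
    by rewrite eqxx; case: eqVneq.
  case: (eqVneq r j) => [->|rj]; first by rewrite eqxx.
  by rewrite (negbTE ri) (negbTE rj).
pose pi k := ((k %/ n) * n + s (k %% n))%N.
have piK k : pi (pi k) = k.
  by rewrite /pi divnMD_small // modnMD_small // sK -divn_eq.
exists pi; split=> [|k]; first by exists pi.
rewrite /slot /spread /pi modnMD_small // divnMD_small //.
suff -> : (s (k %% n)%N == j) = (k %% n == i)%N by [].
rewrite /s; have [_|ki] := eqVneq (k %% n)%N i; first exact: eqxx.
have [kj|/negbTE//] := eqVneq (k %% n)%N j.
by apply/negbTE; rewrite -kj eq_sym.
Qed.

(** [spread] takes families indexed by [nat], so [a] is extended by 0 through [insub]. *)
Lemma sum_slots n (a : 'I_n -> R) x : (0 < n)%N ->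
  (fun k => \sum_(i < n) a i * slot n i x k) =
  spread n (fun j k => oapp a 0 (insub j) * x k).
Proof.
move=> n0; rewrite [RHS]spreadE //; apply/funext => k; apply: eq_bigr => i _.
rewrite /slot /spread; case: eqP => [_|_]; last by rewrite mulr0.
by rewrite valK.
Qed.

Lemma exists_large_pow (g B : R) : 0 < g -> exists2 Q : nat, (0 < Q)%N & B <= Q%:R `^ g.
Proof.
move=> g0; pose c := `|B| `^ g^-1; exists (Num.truncn c).+1 => //.
apply: le_trans (ler_norm B) _.
rewrite (_ : `|B| = c `^ g); last by rewrite /c -powRrM mulVf ?gt_eqF // powRr1.
rewrite ge0_ler_powR ?nnegrE ?powR_ge0 ?(ltW g0) //.
exact/ltW/Num.Theory.truncnS_gt.
Qed.

(** For exponent 0 the sum of [n] disjoint copies has nearly the norm of one. The combination lies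
    between each single piece and [max |a_i|] times that sum. *)
Lemma sup_representable : almost_power X Nrm 0 -> sym_fin_rep X Nrm +oo%E.
Proof.
move=> ap n n0 eps eps0.
have [x [Xx x1 eig]] := approximate_eigenvector HX ap n eps0.
have Xs i : (i < n)%N -> X (slot n i x).
  by move=> ilt; apply/(mem_dom HX Xx)/dom_spread_slot.
exists (fun i : 'I_n => slot n i x); split=> [i|i j ij k|i j|a].
- exact: Xs.
- exact: slot_disjoint.
- exact: slot_same_distribution.
rewrite sum_slots //=; set mx := \big[_/_]_(_ < _) _.
have mx0 : 0 <= mx by apply: bigmax_ge_id.
have amx (i : 'I_n) : `|a i| <= mx by exact: (le_bigmax _ (fun i => `|a i|) i).
pose v j k := oapp a 0 (insub j) * x k.
have Xv j : X (v j) by exact: (memZ HX).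
have XS : X (spread n v) by exact: (mem_spread HX).
have up_x : Nrm (sigma_up n x) <= 1 + eps.
  have Xsx := mem_up HX n0 Xx.
  have := nrm_triB HX Xsx Xx; have := eig n; rewrite n0 leqnn powRr0 mulr1 x1.
  rewrite (_ : (fun k => _ - 1 * x k) = fun k => sigma_up n x k - x k) => [|].
    by move=> /(_ isT); lra.
  by apply/funext => k; rewrite mul1r.
apply/andP; split.
  apply: le_trans (_ : mx <= _).
    by rewrite ler_piMl // invf_le1; lra.
  apply: bigmax_le => [|i _]; first exact: (nrm_ge0 HX).
  have := nrm_dom HX XS (dom_slot v (ltn_ord i)).
  by rewrite {1}/v (nrmZ HX) // x1 mulr1 valK.
apply: le_trans (_ : Nrm (fun k => mx * sigma_up n x k) <= _).
  apply: (nrm_le HX) => [|k]; first exact/(memZ HX)/(mem_up HX).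
  rewrite /spread !normrM ler_wpM2r // (ger0_norm mx0).
  by case: insubP => [i _ _|] /=; rewrite ?amx ?normr0.
rewrite (nrmZ HX) ?ger0_norm //; last exact: (mem_up HX).
by rewrite mulrC ler_wpM2r.
Qed.

Lemma lp_representable (g : R) : 0 < g <= 1 -> almost_power X Nrm g ->
  sym_fin_rep X Nrm (g^-1)%:E.
Proof.
move=> /andP[g0 g1] ap n n0 eps eps0.
have e1 : 0 < 1 + eps by lra.
(* [eps / (1 + eps)] is the tighter of the two sides, as [(1 + eps)^-1 = 1 - eps / (1 + eps)]. One
   half goes to the rounding error, the other to the eigenvector error. *)
pose d := eps / (1 + eps) / 2.
have d0 : 0 < d by rewrite !divr_gt0.
have N0 : 0 < 3 * n%:R + 1 :> R by rewrite ltr_wpDl ?mulr_ge0.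
(* [Q] precedes [x] because it determines how many dilations [x] must respect. Neither depends on
   the coefficients. *)
have [Q Q0 hQ] := exists_large_pow (2 * n%:R / d) g0.
have [x [Xx x1 eig]] := approximate_eigenvector HX ap (Q + n) (divr_gt0 d0 N0).
exists (fun i : 'I_n => slot n i x); split=> [i|i j ij k|i j|a].
- exact/(mem_dom HX Xx)/dom_spread_slot.
- exact: slot_disjoint.
- exact: slot_same_distribution.
rewrite sum_slots //= invrK; set S := \sum_(k < n) _.
have S0 : 0 <= S by apply: sumr_ge0 => i _; rewrite powR_ge0.
move: S0; rewrite le_eqVlt => /orP[/eqP S0|S0].
  have a0 i : a i = 0.
    have /eqP := esym S0; rewrite psumr_eq0 => [/allP /(_ i)|j _]; last exact: powR_ge0.
    by rewrite mem_index_enum powR_eq0 normr_eq0 => /(_ isT) /andP[/eqP].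
  rewrite -S0 powR0 ?gt_eqF // !mulr0 (_ : spread _ _ = fun=> 0) ?(nrm0 HX) ?lexx //.
  by apply/funext => k; rewrite /spread; case: insubP => [i _ _|_] /=; rewrite ?a0 mul0r.
pose b j := `|oapp a 0 (insub j)|.
pose t j := b j `^ g^-1 / S.
have bE (i : 'I_n) : b i = `|a i| by rewrite /b valK.
have b0 j : 0 <= b j by rewrite normr_ge0.
have t0 j : 0 <= t j by rewrite divr_ge0 ?powR_ge0 ?ltW.
have tsum : \sum_(i < n) t i = 1.
  rewrite -mulr_suml (eq_bigr (fun i => `|a i| `^ g^-1)) => [|i _]; last by rewrite bE.
  by rewrite divff ?gt_eqF.
have t01 i : (i < n)%N -> 0 <= t i <= 1.
  move=> ilt; rewrite t0 -tsum (bigD1 (Ordinal ilt)) //= lerDl.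
  by apply: sumr_ge0.
have tS j : b j = S `^ g * t j `^ g.
  rewrite -powRM ?(ltW S0) // mulrC divfK ?gt_eqF // -powRrM mulVf ?gt_eqF //.
  by rewrite powRr1.
have g01 : 0 <= g <= 1 by rewrite ltW.
have est := lp_estimate HX g01 (ltW (divr_gt0 d0 N0)) n0 Q0 t01 tsum Xx x1 eig.
have XT : X (spread n (fun i k => t i `^ g * x k)).
  by apply: (mem_spread HX) => // i _; exact: (memZ HX).
have -> : Nrm (spread n (fun j k => oapp a 0 (insub j) * x k)) =
    S `^ g * Nrm (spread n (fun i k => t i `^ g * x k)).
  rewrite -[in RHS](ger0_norm (powR_ge0 S g)) -(nrmZ HX) //.
  apply: (nrm_eq HX) => [|k]; first exact: (memZ HX).
  rewrite /spread mulrA normrM -tS.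
  by rewrite [RHS]normrM (ger0_norm (b0 _)).
have Sg0 : 0 < S `^ g by rewrite powR_gt0.
rewrite ![_ * S `^ g]mulrC !ler_pM2l //.
have Qp : 0 < Q%:R :> R by rewrite ltr0n.
have est2 : `|Nrm (spread n (fun i k => t i `^ g * x k)) - 1| <= eps / (1 + eps).
  apply: le_trans est _.
  have -> : eps / (1 + eps) = d + d by rewrite /d -splitr.
  apply: lerD; last by rewrite mulrCA divff ?mulr1 // gt_eqF.
  have -> : Q%:R^-1 `^ g = (Q%:R `^ g)^-1.
    by rewrite -powR_inv1 ?ler0n // -powRrM mulN1r powRN.
  by rewrite ler_pdivrMr ?powR_gt0 // [leRHS]mulrC -ler_pdivrMr.
have inv_eps : (1 + eps)^-1 = 1 - eps / (1 + eps) by field; rewrite gt_eqF.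
have eps_le : eps / (1 + eps) <= eps by rewrite ler_pdivrMr // ler_peMr //; lra.
move: est2; rewrite ler_norml => /andP[lo hi].
by rewrite inv_eps; apply/andP; split; lra.
Qed.

Lemma calF_almost_power (g : R) : 0 <= g <= 1 -> almost_power X Nrm g ->
  calF X Nrm (einv g).
Proof.
move=> /andP[g0 g1] ap; rewrite /einv; case: eqP => [gE|/eqP gn0].
  by split; [rewrite leey | apply: sup_representable; rewrite -gE].
have gp : 0 < g by rewrite lt_neqAle eq_sym gn0.
split; last by apply: lp_representable => //; rewrite gp.
by rewrite lee_fin -invr1 lef_pV2 // posrE.
Qed.

Section DisjointCopies.
Variables (n : nat) (x : 'I_n -> nat -> R) (i0 : 'I_n).
Hypothesis disj : forall i j, i != j -> forall k, x i k = 0 \/ x j k = 0.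
Hypothesis same : forall i j, same_ordered_distribution (x i) (x j).

Let n0 : (0 < n)%N. Proof. exact: leq_ltn_trans (leq0n i0) (ltn_ord i0). Qed.
Let S := fun k => \sum_(i < n) x i k.

Lemma sum_disjoint i k : x i k != 0 -> S k = x i k.
Proof.
move=> xik; rewrite /S (bigD1 i) //= big1 ?addr0 // => j ji.
by have [//|xi0] := disj ji k; rewrite xi0 eqxx in xik.
Qed.

Lemma disjoint_unique i j k : x i k != 0 -> x j k != 0 -> i = j.
Proof.
move=> xik xjk; apply/eqP/negPn/negP => ij.
by have [xi0|xj0] := disj ij k; [rewrite xi0 eqxx in xik | rewrite xj0 eqxx in xjk].
Qed.

(** The [i]-th interleaved copy of [x i0] is carried onto [x i] by their permutation. Images under
    different permutations may collide, but not on the supports, which are disjoint. *)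
Lemma dom_up_copies : dominated (sigma_up n (x i0)) S /\ dominated S (sigma_up n (x i0)).
Proof.
have /choice[pi piP] := same i0.
have lt k : (k %% n < n)%N by rewrite ltn_mod.
pose r k : 'I_n := Ordinal (lt k).
split.
  exists (fun k => pi (r k) (k %/ n)%N); split=> [k l|k].
    rewrite /sigma_up => xk xl kl.
    have [bk pk] := piP (r k); have [bl pl] := piP (r l).
    have rkl : r k = r l.
      by apply: (@disjoint_unique _ _ (pi (r k) (k %/ n)%N)); rewrite ?pk // kl pl.
    apply: (@divmod_inj n); first exact: (congr1 val rkl).
    by move: kl; rewrite rkl; exact: (bij_inj bl).
  rewrite /sigma_up => xk; have [bk pk] := piP (r k).
  by rewrite (sum_disjoint (i := r k)) pk.
have /choice[f fP] : forall k, exists l, S k != 0 ->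
    pi (r l) (l %/ n)%N = k /\ x i0 (l %/ n)%N = S k.
  move=> k; have [Sk|Sk] := eqVneq (S k) 0; first by exists 0%N.
  have [i xik] : exists i, x i k != 0.
    apply: contrapT => H; move/eqP: Sk; apply; apply: big1 => i _.
    by apply/eqP/negPn/negP => xi; apply: H; exists i.
  have [[q piq qpi] pk] := piP i.
  exists (q k * n + i)%N => _; rewrite divnMD_small //.
  have -> : r (q k * n + i)%N = i by apply: val_inj; rewrite /= modnMD_small.
  by rewrite qpi -pk qpi (sum_disjoint xik).
exists f; split=> [k l Sk Sl kl|k /fP[_ xk]]; last by rewrite /sigma_up xk.
by have [<- _] := fP _ Sk; have [<- _] := fP _ Sl; rewrite kl.
Qed.

End DisjointCopies.

Hypothesis X_neq0 : exists x, X x /\ x <> (fun=> 0).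

(** Here [s] stands for [1 / p]. Representability with [eps = 1] loses a factor 2 for the sum of the
    copies and a factor 2 for a single copy, hence the 4; constants do not affect exponents. *)
Lemma representable_opnorms (p : \bar R) (s : R) (n : nat) (n0 : (0 < n)%N) :
  sym_fin_rep X Nrm p -> 0 <= s ->
  pnorm p (fun _ : 'I_n => 1) = n%:R `^ s ->
  pnorm p (fun i : 'I_n => (i == Ordinal n0)%:R) = 1 ->
  n%:R `^ s <= 4 * opnorm X Nrm (sigma_up n) /\
  n%:R `^ (- s) <= 4 * opnorm X Nrm (sigma_down n).
Proof.
move=> rep s0 p1 pd; set i0 := Ordinal n0.
have [x [Xx disj same bnd]] := rep n n0 1 ltr01.
have := bnd (fun=> 1); have := bnd (fun i => (i == i0)%:R).
rewrite p1 pd !ler_pdivrMl //.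
have -> : (fun k => \sum_(i < n) (i == i0)%:R * x i k) = x i0.
  apply/funext => k; rewrite (bigD1 i0) // eqxx mul1r big1 /= ?addr0 // => i.
  by move=> /negbTE ->; rewrite mul0r.
have -> : (fun k => \sum_(i < n) 1 * x i k) = (fun k => \sum_(i < n) x i k).
  by apply/funext => k; apply: eq_bigr => i _; rewrite mul1r.
move=> /andP[x_lo x_hi] /andP[S_lo S_hi].
have XS := mem_sum HX (index_enum 'I_n) Xx.
have [dom1 dom2] := dom_up_copies i0 disj same.
have Xup := mem_up HX n0 (Xx i0).
have up_S := nrm_dom HX XS dom1; have S_up := nrm_dom HX Xup dom2.
have h1 := up_ub HX n0 (Xx i0); have h2 := down_lb HX n0 (Xx i0).
have b0 := up_gt0 HX X_neq0 n0; have a0 := down_gt0 HX X_neq0 n0.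
have v0 : 0 < n%:R `^ s by rewrite powR_gt0 ?ltr0n.
split; first by have := ler_wpM2l (ltW b0) x_hi; lra.
rewrite powRN -[leLHS]mul1r ler_pdivrMr //.
have := ler_wpM2l (ltW a0) up_S; have := ler_wpM2l (ltW a0) S_hi.
lra.
Qed.

End Representability.

(** * Comparison of exponents and conclusion *)

Lemma exponent_le (R : realType) (s t : R) (f : nat -> R) :
  (exists c : R, forall m, (0 < m)%N -> m%:R `^ s <= c * f m) ->
  (forall m, (0 < m)%N -> 0 < f m) ->
  (forall eta, 0 < eta -> exists2 C, 0 < C & forall m, (0 < m)%N ->
     f m <= C * m%:R `^ (t + eta)) ->
  s <= t.
Proof.
move=> [c hc] f0 hf; rewrite leNgt; apply/negP => ts.
pose e := (s - t) / 2; have e0 : 0 < e by rewrite divr_gt0 // subr_gt0.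
have [C C0 hC] := hf e e0.
have [Q Q0 hQ] := exists_large_pow (`|c| * C + 1) e0.
have A0 : 0 < Q%:R `^ (t + e) by rewrite powR_gt0 ?ltr0n.
have h1 : Q%:R `^ s <= `|c| * (C * Q%:R `^ (t + e)).
  apply: le_trans (hc Q Q0) _; apply: le_trans (_ : `|c| * f Q <= _).
    by rewrite ler_wpM2r ?ler_norm // ltW // f0.
  by rewrite ler_wpM2l // hC.
have sE : s = (t + e) + e by rewrite /e; field.
move: h1; rewrite {1}sE powR_natD // mulrA mulrC ler_pM2r //.
lra.
Qed.

(** The zero space is excluded: it contains no copy of any [l^p], so its set of exponents is
    empty. *)
Theorem theorem3p5 (R : realType) (X : set (nat -> R)) (Nrm : (nat -> R) -> R) :
  symmetric_seq_space X Nrm ->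
  (exists x, X x /\ x <> (fun _ => 0)) ->
  [/\ calF X Nrm !=set0,
      calF X Nrm (einv (boyd_alpha X Nrm)),
      (forall p, calF X Nrm p -> (p <= einv (boyd_alpha X Nrm))%E),
      calF X Nrm (einv (boyd_beta X Nrm)) &
      (forall p, calF X Nrm p -> (einv (boyd_beta X Nrm) <= p)%E)].
Proof.
move=> HX X_neq0.
have [b_lo b_hi] := beta_growth HX X_neq0.
have [a_lo a_hi] := alpha_growth HX X_neq0.
set al := boyd_alpha X Nrm in a_lo a_hi *.
set bt := boyd_beta X Nrm in b_lo b_hi *.
have bp := up_gt0 HX X_neq0; have ap := down_gt0 HX X_neq0.
have pow_self (t : R) (m : nat) eta : (0 < m)%N -> 0 < eta ->
    m%:R `^ t <= 1 * m%:R `^ (t + eta) :> R.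
  by move=> m0 e0; rewrite mul1r ler_powR ?ler1n // lerDl ltW.
have bt0 : 0 <= bt.
  apply: exponent_le b_hi => //; exists 1 => m m0.
  by rewrite powRr0 mul1r up_ge1.
have bt1 : bt <= 1.
  apply: (@exponent_le R bt 1 (fun m => m%:R)) => [|m m0|eta e0].
  - exists 1 => m m0; rewrite mul1r; apply: le_trans (b_lo m m0) _.
    exact: (up_le_nat HX).
  - by rewrite ltr0n.
  - exists 1 => // m m0; rewrite -{1}[m%:R]powRr1 //; exact: pow_self.
have al0 : 0 <= al.
  rewrite -oppr_le0; apply: (@exponent_le R (- al) 0 (fun=> 1)) => [|//|eta e0].
    exists 1 => m m0; rewrite mul1r; apply: le_trans (a_lo m m0) _.
    exact: (down_le1 HX).
  by exists 1 => // m m0; rewrite -[leLHS](powRr0 m%:R); exact: pow_self.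
have al1 : al <= 1.
  rewrite -lerN2; apply: exponent_le a_hi => //; exists 1 => m m0.
  by rewrite mul1r powR_inv1 // down_ge_inv.
(* Finite and infinite [p] are treated together through the two values of [pnorm] that matter, at
   the all-ones vector and at a unit vector. *)
have ratio (p : \bar R) (s : R) : calF X Nrm p -> 0 <= s ->
    (forall n, (0 < n)%N -> pnorm p (fun _ : 'I_n => 1) = n%:R `^ s) ->
    (forall n (i0 : 'I_n), pnorm p (fun i : 'I_n => (i == i0)%:R) = 1) ->
    al <= s <= bt.
  move=> [_ rep] s0 p1 pd.
  have H m m0 := representable_opnorms HX X_neq0 rep s0 (p1 m m0) (pd m (Ordinal m0)).
  apply/andP; split.
    rewrite -lerN2; apply: exponent_le a_hi => //; exists 4 => m m0.
    by case: (H m m0).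
  by apply: exponent_le b_hi => //; exists 4 => m m0; case: (H m m0).
have bounds p : calF X Nrm p -> (einv bt <= p <= einv al)%E.
  case: p => [r|Foo|[]//].
    move=> Fp; have [r1 _] := Fp; rewrite lee_fin in r1; have r0 : 0 < r by apply: lt_le_trans r1.
    have /andP[als sbt] : al <= r^-1 <= bt.
      apply: (ratio r%:E) => // [|n n0|n i0] /=; first by rewrite invr_ge0 ltW.
        rewrite (eq_bigr (fun=> 1)) => [|k _]; last by rewrite normr1 powR1.
        by rewrite sumr_const card_ord.
      rewrite (bigD1 i0) //= eqxx normr1 powR1 big1 ?addr0 ?powR1 // => i /negbTE ->.
      by rewrite normr0 powR0 // gt_eqF.
    have btp : 0 < bt by apply: lt_le_trans sbt; rewrite invr_gt0.
    rewrite /einv gt_eqF // lee_fin invf_ple ?posrE // sbt /=.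
    case: eqP => [_|/eqP aln0]; first by rewrite leey.
    have alp : 0 < al by rewrite lt_neqAle eq_sym aln0.
    by rewrite lee_fin -[r]invrK lef_pV2 ?posrE ?invr_gt0.
  (* For [p = +oo] the exponent is 0, which forces [al = 0], so that [einv al] is infinite too. *)
  have /andP[als _] : al <= 0 <= bt.
    have max1 n (i0 : 'I_n) (f : 'I_n -> R) : (forall i, `|f i| <= 1) -> f i0 = 1 ->
        \big[Num.max/0]_(k < n) `|f k| = 1.
      move=> f1 fi0; apply/eqP; rewrite eq_le; apply/andP; split.
        by apply: bigmax_le => // i _; exact: f1.
      by apply: le_trans (le_bigmax _ (fun i => `|f i|) i0); rewrite fi0 normr1.
    apply: (ratio +oo%E) => // [n n0|n i0] /=.
      by rewrite powRr0; apply: (max1 _ (Ordinal n0)) => // i; rewrite normr1.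
    by apply: (max1 _ i0) => [i|]; rewrite ?eqxx //; case: (i == i0); rewrite ?normr1 ?normr0.
  have alE : al = 0 by apply/eqP; rewrite eq_le als.
  by rewrite leey /einv alE eqxx lexx.
have Fal : calF X Nrm (einv al).
  apply: (calF_almost_power HX); first by rewrite al0.
  exact: (alpha_almost_power HX X_neq0).
have Fbt : calF X Nrm (einv bt).
  apply: (calF_almost_power HX); first by rewrite bt0.
  exact: (beta_almost_power HX X_neq0).
by split=> // [|p /bounds /andP[]|p /bounds /andP[]] //; exists (einv al).
Qed.
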